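(* Let $d\in\mathbb{N}$, let $P$ be a stationary and ergodic probability measure on $\Omega=[0,1]^{\mathcal{K}^d}$, and fix an integer $0\le q<d$ and $t\in[0,1]$. Then there exists a non-random constant $\widehat\beta_q(t)$ (depending on $d,q,t$) such that $$\lim_{n\to\infty}\frac{1}{|\Lambda_n|}\beta_q^n(t)=\widehat\beta_q(t)\quad\text{almost surely.}$$
   Context: An elementary interval is a closed interval $[l,l+1]$ or a degenerate interval $[l]=[l,l]$ with $l\in\mathbb{Z}$. An elementary cube in $\mathbb{R}^d$ is a product $Q=I_1\times\cdots\times I_d$ of elementary intervals; its dimension is the number of nondegenerate factors. $\mathcal{K}^d$ denotes the set of all elementary cubes in $\mathbb{R}^d$. A cubical set is a (possibly infinite) union of elementary cubes. For a cubical set $X$, the cubical chain complex has $C_k(X)$ the free $\mathbb{Z}$-module generated by the $k$-dimensional elementary cubes contained in $X$, with the standard cubical boundary operator $\partial\widehat Q=\sum_{j=1}^k(-1)^{j-1}(\widehat{Q_j^+}-\widehat{Q_j^-})$, where $Q_j^\pm$ replace the $j$-th nondegenerate factor $[l_j,l_j+1]$ by $[l_j+1]$, resp. $[l_j]$. $H_k(X)$ is its homology; for bounded $X$, $H_k(X)\cong T_k\oplus\mathbb{Z}^{\beta_k(X)}$ with $T_k$ torsion, and $\beta_k(X)$ is the $k$-th Betti number. Random model: $\Omega=[0,1]^{\mathcal{K}^d}$ with product topology and Borel $\sigma$-field; configurations $\omega=(\omega_Q)_{Q\in\mathcal{K}^d}$. For $x\in\mathbb{Z}^d$, $\tau_x\omega=(\omega_{-x+Q})_{Q}$.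 $P$ is stationary if $P(\tau_x^{-1}A)=P(A)$ for all $x\in\mathbb{Z}^d$ and measurable $A$, and ergodic if every $A$ with $\tau_x^{-1}A=A$ for all $x$ has $P(A)\in\{0,1\}$. For $t\in[0,1]$, $X(t)=\bigcup\{Q\in\mathcal{K}^d:\omega_Q\le t\}$, $\Lambda_n=[-n,n]^d$, $X^n(t)=X(t)\cap\Lambda_n$, $\beta_q^n(t)=\beta_q(X^n(t))$, and $|\cdot|$ is Lebesgue measure (so $|\Lambda_n|=(2n)^d$). *)

(* Defs.v *)
From HB Require Import structures.
From mathcomp Require Import all_boot all_order all_algebra.
From mathcomp Require Import all_classical all_reals all_analysis.

Unset Printing Implicit Defensive.

Import Order.TTheory GRing.Theory Num.Theory.
Local Open Scope classical_set_scope.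
Local Open Scope ring_scope.

(* An elementary interval is encoded as (l, b) : int * bool:
   b = true  encodes the nondegenerate interval [l, l+1],
   b = false encodes the degenerate interval [l] = [l, l].
   An elementary cube in R^d is a d-tuple of elementary intervals. *)
Definition cube (d : nat) := {ffun 'I_d -> (int * bool)%type}.

Definition cube_dim {d} (Q : cube d) : nat := #|[set i | (Q i).2]|.

Definition cube_set (R : realType) d (Q : cube d) : set ('I_d -> R) :=
  [set x | forall i, ((Q i).1)%:~R <= x i <= ((Q i).1)%:~R + ((Q i).2)%:R].

Definition cube_upd {d} (Q : cube d) (i : 'I_d) (v : int * bool) : cube d :=
  [ffun j => if j == i then v else Q j].

Definition cube_shift {d} (x : 'I_d -> int) (Q : cube d) : cube d :=
  [ffun i => ((Q i).1 + x i, (Q i).2)].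

(* For a nondegenerate coordinate i of Q, (cube_rank Q i).+1 is the index j
   of i among the nondegenerate factors of Q, and Q_j^+ / Q_j^- replace
   [l, l+1] at coordinate i by [l+1] / [l]. *)
Definition cube_rank {d} (Q : cube d) (i : 'I_d) : nat :=
  #|[set i' : 'I_d | (i' < i)%N && (Q i').2]|.
Definition face_plus {d} (Q : cube d) (i : 'I_d) : cube d :=
  cube_upd Q i (((Q i).1 + 1)%R, false).
Definition face_minus {d} (Q : cube d) (i : 'I_d) : cube d :=
  cube_upd Q i ((Q i).1, false).

(* coefficient of the cube P in  d^Q = sum_j (-1)^(j-1) (Q_j^+ - Q_j^-) *)
Definition bd_coef {d} (Q P : cube d) : int :=
  \sum_(i < d | (Q i).2)
     (-1) ^+ (cube_rank Q i) *
       (((P == face_plus Q i) : int) - ((P == face_minus Q i) : int)).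

Definition chain d := cube d -> int.

(* all cubes Q with bd_coef Q P possibly nonzero (each listed once) *)
Definition coface_cands {d} (P : cube d) : seq (cube d) :=
  undup (flatten [seq [:: cube_upd P i (((P i).1 - 1)%R, true);
                          cube_upd P i ((P i).1, true)] | i <- enum 'I_d]).

(* linear extension of the boundary: (bd c) P = sum_Q c Q * bd_coef Q P;
   only the cubes in coface_cands P can contribute. *)
Definition bd {d} (c : chain d) : chain d :=
  fun P => \sum_(Q <- coface_cands P) c Q * bd_coef Q P.

Definition in_chains {R : realType} {d} (X : set ('I_d -> R)) (k : nat)
    (c : chain d) : Prop :=
  (exists s : seq (cube d), forall Q, c Q != 0 -> Q \in s) /\
  (forall Q, c Q != 0 -> cube_dim Q = k /\ @cube_set R d Q `<=` X).

Definition is_cycle {R : realType} {d} (X : set ('I_d -> R)) k (z : chain d) :=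
  in_chains X k z /\ forall P, bd z P = 0.

Definition is_boundary {R : realType} {d} (X : set ('I_d -> R)) k (b : chain d) :=
  exists c, in_chains X k.+1 c /\ forall P, b P = bd c P.

Definition hom_indep {R : realType} {d} (X : set ('I_d -> R)) (k m : nat) : Prop :=
  exists z : 'I_m -> chain d,
    (forall i, is_cycle X k (z i)) /\
    (forall a : 'I_m -> int,
        is_boundary X k (fun P => \sum_(i < m) a i * z i P) ->
        forall i, a i = 0).

(* Betti number beta_k(X) = rank of H_k(X) = maximal number of
   Z-linearly independent elements of H_k(X) (for bounded X this is the
   beta with H_k(X) ~ T_k (+) Z^beta). *)
Definition betti {R : realType} {d} (X : set ('I_d -> R)) (k : nat) : nat :=
  xget 0%N [set b | hom_indep X k b /\ forall m, hom_indep X k m -> (m <= b)%N].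

(* Omega = functions K^d -> R with the product (cylinder) sigma-algebra,
   generated by the coordinate maps omega |-> omega_Q with Borel sets;
   probability measures are required to be supported on [0,1]^{K^d}. *)
Definition config (R : realType) (d : nat) := cube d -> R.
Section config_pointed.
Variables (R : realType) (d : nat).
HB.instance Definition _ := Choice.on (config R d).
HB.instance Definition _ := isPointed.Build (config R d) (fun _ => 0%R).
End config_pointed.

Definition cylinders (R : realType) (d : nat) : set (set (config R d)) :=
  [set A | exists (Q : cube d) (B : set R),
      measurable B /\ A = (fun w : config R d => w Q) @^-1` B].

Definition Omega (R : realType) (d : nat) := g_sigma_algebraType (cylinders R d).

Definition tau {R : realType} {d} (x : 'I_d -> int) (w : Omega R d) : Omega R d :=
  fun Q => w (cube_shift (fun i => - x i) Q).

Definition stationary {R : realType} {d} (P : probability (Omega R d) R) : Prop :=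
  forall (x : 'I_d -> int) (A : set (Omega R d)),
    measurable A -> P (tau x @^-1` A) = P A.

Definition ergodic {R : realType} {d} (P : probability (Omega R d) R) : Prop :=
  forall A : set (Omega R d), measurable A ->
    (forall x : 'I_d -> int, tau x @^-1` A = A) ->
    P A = 0%E \/ P A = 1%E.

Definition Xt {R : realType} {d} (w : Omega R d) (t : R) : set ('I_d -> R) :=
  [set x | exists Q : cube d, w Q <= t /\ @cube_set R d Q x].

Definition Lambda (R : realType) d (n : nat) : set ('I_d -> R) :=
  [set x | forall i, - (n%:R) <= x i <= n%:R].

Definition Xn {R : realType} {d} (w : Omega R d) (t : R) (n : nat) :=
  Xt w t `&` Lambda R d n.

Definition beta_n {R : realType} {d} (w : Omega R d) (q n : nat) (t : R) : nat :=
  betti (Xn w t n) q.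

(* Main.v *)
Require Import Defs.
From mathcomp Require Import all_boot all_order all_algebra.
From mathcomp Require Import all_classical all_reals all_analysis.
From mathcomp Require Import measurable_realfun ring lra zify.
Set Implicit Arguments.
Unset Strict Implicit.
Unset Printing Implicit Defensive.
Import Order.TTheory GRing.Theory Num.Theory.
Import numFieldNormedType.Exports.
Local Open Scope classical_set_scope.
Local Open Scope ring_scope.

(** Over the rationals, the dimension of a space of chains is the number of
    cubes that occur as the largest cube of some chain of the space, for a
    fixed total order on cubes.  With a translation-invariant order this gives
    [beta_q(X) = z_q(X) + z_(q+1)(X) - N_(q+1)(X)], where [z_k(X)] counts the
    cubes leading a [k]-cycle of [X] and [N_k(X)] counts the [k]-cubes of [X].
    For [X = X^n(t)], [z_k] lies between the number of cubes in a slightly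
    smaller box that lead a cycle of [X(t)] staying at distance at most [K],
    and the number of cubes in a slightly larger box that lead some finite
    cycle of [X(t)].  Both are sums over a box of translates of one bounded
    local function, so the multiparameter ergodic theorem applies (Birkhoff's
    theorem in each direction, iterated following Dunford), and the two
    densities agree in the limit [K -> oo]. *)

(** The rank of homology is not a sum of local contributions, since a cycle may run through the
    whole window before it closes. Leading some cycle is, by contrast, a property of a single cube;
    it moves with translations, and it can only become true when [X] grows. This monotonicity yields
    both bounds with no estimate of how far cycles reach, as every cycle of the window is a cycle of
    [X(t)]. The densities agree because a finite cycle has bounded extent: the events with cut-off
    [K] increase to the event without cut-off, and bounded convergence applies. Boundaries are never
    localised: rank-nullity in degree [q+1] trades their dimension for a number of cubes minus a
    number of leading cubes. Homology has integer coefficients, but [betti] counts independent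
    classes only, so passing to rational chains and back by clearing denominators loses nothing. *)

(** * Upper limits of bounded real sequences *)

Section LimSup.
Variable R : realType.
Implicit Types (u v : nat -> R) (c M : R).

(** Boundedness is what lets [limn_sup] be read as the infimum of the tail suprema; hence the
    explicit bound [M] in the lemmas of this section. *)
Lemma bounded_seqP u M : (forall n, `|u n| <= M) -> bounded_fun (u : nat -> R^o).
Proof.
move=> uM; exists M; split; first by rewrite num_real.
by move=> x Mx n _ /=; exact: le_trans (uM n) (ltW Mx).
Qed.

Lemma limn_sup_ltP u M c : (forall n, `|u n| <= M) -> limn_sup u < c ->
  exists N, forall n, (N <= n)%N -> u n < c.
Proof.
move=> uM; have bu := bounded_seqP uM; rewrite limn_supE// => uc.
have hl := bounded_fun_has_lbound_sups bu.
have [|_ [N _ <-] Nc] := inf_lt _ uc.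
  by exists (sups u 0), 0%N.
exists N => n Nn; apply: le_lt_trans Nc.
by apply: ub_le_sup; [exact/has_ubound_sdrop/bounded_fun_has_ubound|exists n].
Qed.

Lemma lt_limn_supP u M c : (forall n, `|u n| <= M) -> c < limn_sup u ->
  forall N, exists2 n, (N <= n)%N & c < u n.
Proof.
move=> uM; have bu := bounded_seqP uM; rewrite limn_supE// => cu N.
have hl := bounded_fun_has_lbound_sups bu.
have : c < sups u N by apply: lt_le_trans cu _; apply: ge_inf => //; exists N.
move=> /sup_gt[|_ [n /= Nn <-] cn]; first by exists (u N); exists N => /=.
by exists n.
Qed.

Lemma norm_limn_sup u M : (forall n, `|u n| <= M) -> `|limn_sup u| <= M.
Proof.
move=> uM; rewrite ler_norml; apply/andP; split; rewrite leNgt; apply/negP.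
  move=> /(limn_sup_ltP uM)[N /(_ N (leqnn _))]; apply/negP; rewrite -leNgt.
  by have := uM N; rewrite ler_norml => /andP[].
move=> /(lt_limn_supP uM)/(_ 0%N)[n _]; apply/negP; rewrite -leNgt.
exact: le_trans (ler_norm _) (uM n).
Qed.

Lemma limn_sup_le_cvg0 u v M :
  (forall n, `|u n| <= M) -> (forall n, `|v n| <= M) ->
  (fun n => u n - v n) @ \oo --> (0 : R) -> limn_sup u <= limn_sup v.
Proof.
move=> uM vM /cvgrPdist_lt uv; apply/ler_addgt0Pr => e e0.
rewrite leNgt; apply/negP => lt_vu.
have e20 : 0 < e / 2 by rewrite divr_gt0.
have /(_ _ e20)[N1 _ N1P] := uv.
have /(limn_sup_ltP vM)[N2 N2P] : limn_sup v < limn_sup v + e / 2.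
  by rewrite ltrDl.
have [n] := lt_limn_supP uM lt_vu (maxn N1 N2).
rewrite geq_max => /andP[/N1P/= + /N2P]; rewrite sub0r normrN ltr_norml.
by move=> /andP[_]; lra.
Qed.

Lemma eq_limn_sup_cvg0 u v M :
  (forall n, `|u n| <= M) -> (forall n, `|v n| <= M) ->
  (fun n => u n - v n) @ \oo --> (0 : R) -> limn_sup u = limn_sup v.
Proof.
move=> uM vM uv; apply/eqP; rewrite eq_le; apply/andP; split.
  exact: limn_sup_le_cvg0 uv.
apply: limn_sup_le_cvg0 vM uM _.
rewrite (_ : (fun _ => _) = -%R \o (fun n => u n - v n)).
  by rewrite -oppr0; exact: cvgN.
by apply/funext => n /=; rewrite opprB.
Qed.

(** The upper limit of [- u] is minus the lower limit of [u], so the hypothesis says that the upper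
    limit does not exceed the lower one. *)
Lemma cvg_limn_supN u M : (forall n, `|u n| <= M) ->
  limn_sup u + limn_sup (fun n => - u n) <= 0 -> u @ \oo --> limn_sup u.
Proof.
move=> uM le0; apply/cvgrPdist_lt => e e0.
have uMN n : `|- u n| <= M by rewrite normrN.
have /(limn_sup_ltP uM)[N1 N1P] : limn_sup u < limn_sup u + e by rewrite ltrDl.
have /(limn_sup_ltP uMN)[N2 N2P] :
  limn_sup (fun n => - u n) < limn_sup (fun n => - u n) + e by rewrite ltrDl.
exists (maxn N1 N2) => // n /=; rewrite geq_max => /andP[/N1P + /N2P].
by rewrite ltr_norml; lra.
Qed.

Lemma limn_sup_addN_ge0 u M : (forall n, `|u n| <= M) ->
  0 <= limn_sup u + limn_sup (fun n => - u n).
Proof.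
move=> uM; rewrite leNgt; apply/negP => lt0.
have uMN n : `|- u n| <= M by rewrite normrN.
set a := limn_sup u in lt0 *; set b := limn_sup (fun n => - u n) in lt0 *.
have e0 : 0 < - (a + b) / 2 by lra.
have /(limn_sup_ltP uM)[N1 N1P] : a < a + - (a + b) / 2 by rewrite ltrDl.
have /(limn_sup_ltP uMN)[N2 N2P] : b < b + - (a + b) / 2 by rewrite ltrDl.
have := N1P _ (leq_maxl N1 N2); have := N2P _ (leq_maxr N1 N2).
by lra.
Qed.

End LimSup.

(** * Integrals of bounded measurable functions *)

Section BoundedMeasurable.
Context d (T : measurableType d) (R : realType) (P : probability T R).
Implicit Types f g h : T -> R.

(** Such functions are integrable for a probability and stable under sums, products, upper limits of
    uniformly bounded sequences and composition with measurable maps, so every integrability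
    condition reduces to this one. *)
Definition bmeas f := measurable_fun setT f /\ exists M, forall x, `|f x| <= M.

Lemma bmeas_integrable f : bmeas f -> P.-integrable setT (EFin \o f).
Proof.
move=> [mf [M fM]]; apply: measurable_bounded_integrable => //.
  exact: le_lt_trans (probability_le1 P measurableT) (ltry 1).
exists M; split; first by rewrite num_real.
by move=> x Mx n _ /=; exact: le_trans (fM n) (ltW Mx).
Qed.

Lemma bmeas_cst c : bmeas (fun=> c).
Proof. by split; [exact: measurable_cst|exists `|c|]. Qed.

Lemma bmeasD f g : bmeas f -> bmeas g -> bmeas (fun x => f x + g x).
Proof.
move=> [mf [M fM]] [mg [N gN]]; split; first exact: measurable_funD.
by exists (M + N) => x; exact: le_trans (ler_normD _ _) (lerD _ _).
Qed.

Lemma bmeasM f g : bmeas f -> bmeas g -> bmeas (fun x => f x * g x).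
Proof.
move=> [mf [M fM]] [mg [N gN]]; split; first exact: measurable_funM.
by exists (M * N) => x; rewrite normrM ler_pM.
Qed.

Lemma bmeasZ c f : bmeas f -> bmeas (fun x => c * f x).
Proof. by move=> bf; apply: bmeasM => //; exact: bmeas_cst. Qed.

Lemma bmeasN f : bmeas f -> bmeas (fun x => - f x).
Proof.
by move=> bf; under eq_fun do rewrite -mulN1r; exact: bmeasZ.
Qed.

Lemma bmeasB f g : bmeas f -> bmeas g -> bmeas (fun x => f x - g x).
Proof. by move=> bf /bmeasN; exact: bmeasD. Qed.

Lemma bmeas_norm f : bmeas f -> bmeas (fun x => `|f x|).
Proof.
move=> [mf [M fM]]; split; last by exists M => x; rewrite normr_id.
exact: measurableT_comp.
Qed.

Lemma bmeas_sum I (s : seq I) (F : I -> T -> R) : (forall i, bmeas (F i)) ->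
  bmeas (fun x => \sum_(i <- s) F i x).
Proof.
move=> bF; elim: s => [|i s IH].
  by under eq_fun do rewrite big_nil; exact: bmeas_cst.
by under eq_fun do rewrite big_cons; exact: bmeasD.
Qed.

Lemma bmeas_indic A : measurable A -> bmeas (\1_A : T -> R).
Proof.
move=> mA; split; first exact: measurable_indic.
exists 1 => x; rewrite indicE; case: (_ \in _); rewrite ?normr1 //.
by rewrite normr0.
Qed.

Lemma bmeas_comp f (S : T -> T) : measurable_fun setT S -> bmeas f ->
  bmeas (fun x => f (S x)).
Proof. by move=> mS [mf [M fM]]; split; [exact: measurableT_comp|exists M]. Qed.

Lemma bmeas_limn_sup (F : nat -> T -> R) M :
  (forall n, measurable_fun setT (F n)) -> (forall n x, `|F n x| <= M) ->
  bmeas (fun x => limn_sup (F ^~ x)).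
Proof.
move=> mF FM; split; last by exists M => x; exact: norm_limn_sup.
by apply: measurable_fun_limn_sup => // x _;
  [apply: bounded_fun_has_ubound|apply: bounded_fun_has_lbound];
  apply: bounded_seqP (FM ^~ x).
Qed.

Local Notation E f := (\int[P]_x f x).

Lemma int_cst c : E (fun=> c) = c.
Proof. by rewrite Rintegral_cst// [X in fine X]probability_setT mulr1. Qed.

Lemma intD f g : bmeas f -> bmeas g -> E (fun x => f x + g x) = E f + E g.
Proof. by move=> /bmeas_integrable bf /bmeas_integrable bg; rewrite RintegralD. Qed.

Lemma intB f g : bmeas f -> bmeas g -> E (fun x => f x - g x) = E f - E g.
Proof. by move=> /bmeas_integrable bf /bmeas_integrable bg; rewrite RintegralB. Qed.

Lemma intZ c f : bmeas f -> E (fun x => c * f x) = c * E f.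
Proof. by move=> /bmeas_integrable bf; rewrite RintegralZl. Qed.

Lemma intN f : bmeas f -> E (fun x => - f x) = - E f.
Proof.
move=> bf; rewrite -mulN1r -intZ//; congr Rintegral.
by apply/funext => x; rewrite mulN1r.
Qed.

Lemma int_sum I (s : seq I) (F : I -> T -> R) : (forall i, bmeas (F i)) ->
  E (fun x => \sum_(i <- s) F i x) = \sum_(i <- s) E (F i).
Proof.
move=> bF; elim: s => [|i s IH].
  by rewrite big_nil; under eq_Rintegral do rewrite big_nil; rewrite int_cst.
rewrite big_cons -IH -intD//; last exact: bmeas_sum.
by apply: eq_Rintegral => x _; rewrite big_cons.
Qed.

Lemma le_int f g : bmeas f -> bmeas g -> (forall x, f x <= g x) -> E f <= E g.
Proof.
by move=> /bmeas_integrable bf /bmeas_integrable bg fg; apply: le_Rintegral.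
Qed.

Lemma int_comp (S : T -> T) f : measurable_fun setT S ->
  (forall A, measurable A -> P (S @^-1` A) = P A) -> bmeas f ->
  E (fun x => f (S x)) = E f.
Proof.
move=> mS PS bf; rewrite /Rintegral; congr fine.
have := @integral_pushforward _ _ _ _ _ S mS P setT (EFin \o f).
rewrite preimage_setT => <- //.
- apply: eq_measure_integral => A mA _; exact: PS.
- by apply/measurable_EFinP; case: bf.
- exact: (bmeas_integrable (bmeas_comp mS bf)).
Qed.

Lemma bounded_cvg_int (F : nat -> T -> R) f M :
  (forall n, measurable_fun setT (F n)) -> (forall n x, `|F n x| <= M) ->
  bmeas f -> {ae P, forall x, F ^~ x @ \oo --> f x} ->
  (fun n => E (F n)) @ \oo --> E f.
Proof.
move=> mF FM bf Ff.
have [|||||_ _] := @dominated_convergence _ _ _ P setT measurableT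
    (fun n => EFin \o F n) (EFin \o f) (cst M%:E).
- by move=> n; exact/measurable_EFinP.
- by apply/measurable_EFinP; case: bf.
- apply: filterS Ff => x Fx _; exact: cvg_comp Fx _.
- exact: (bmeas_integrable (bmeas_cst M)).
- by apply: aeW => x n _; rewrite /= lee_fin.
rewrite /= (_ : (\int[P]_x _ = (E f)%:E)%E); first by move/fine_cvgP => [].
rewrite fineK//; exact: integrable_fin_num (bmeas_integrable bf).
Qed.

Lemma ae_eq0_int f : bmeas f -> (forall x, 0 <= f x) -> E f <= 0 ->
  {ae P, forall x, f x = 0}.
Proof.
move=> bf f0 Ef0; have /integrableP[mf _] := bmeas_integrable bf.
have /integrable_fin_num/= := bmeas_integrable bf.
move=> /(_ measurableT) fin.
have : (\int[P]_(x in setT) `|(EFin \o f) x| = 0)%E.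
  under eq_integral do rewrite /= ger0_norm//.
  apply/eqP; rewrite -(fineK fin) eqe eq_le Ef0/=.
  exact: Rintegral_ge0.
move=> /(ae_eq_integral_abs P measurableT mf); apply: filterS => x /(_ I).
by move=> /= [].
Qed.

End BoundedMeasurable.

(** * Birkhoff's ergodic theorem for one map *)

(** Good blocks are peeled off from the left. What remains has length [L <= M]; its sum is at least
    [- L * B] while [L * c <= L * B], which costs at most [2 * M * B], once. *)
Lemma greedy_sum_ge (R : realType) (b : nat -> R) (B c : R) (M : nat) :
  (forall i, `|b i| <= B) -> c <= B ->
  (forall i, exists m, [/\ (0 < m)%N, (m <= M)%N &
     m%:R * c <= \sum_(i <= j < i + m) b j]) ->
  forall L i, L%:R * c - 2 * M%:R * B <= \sum_(i <= j < i + L) b j.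
Proof.
move=> bB cB step; have B0 : 0 <= B by exact: le_trans (bB 0%N).
elim/ltn_ind => L IH i; have [LM|ML] := leqP L M.
  have LMR : L%:R <= M%:R :> R by rewrite ler_nat.
  have L0 : 0 <= L%:R :> R by [].
  have : - (L%:R * B) <= \sum_(i <= j < i + L) b j.
    rewrite -mulNr -[X in X%:R](addKn i L) mulNr mulr_natl -sumr_const_nat.
    rewrite -sumrN; apply: ler_sum => j _.
    by have := bB j; rewrite ler_norml => /andP[].
  nra.
have [m [m0 mM hm]] := step i.
have mL : (m <= L)%N by lia.
rewrite (@big_cat_nat _ _ _ (i + m)) /=; [|by lia..].
have -> : (i + L = i + m + (L - m))%N by lia.
have := IH (L - m)%N ltac:(lia) (i + m)%N.
by rewrite natrB//; lra.
Qed.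

Section Birkhoff.
Context d (T : measurableType d) (R : realType) (P : probability T R).
Local Notation E f := (\int[P]_x f x).

Definition average (u : nat -> R) (n : nat) : R := (\sum_(i < n) u i) / n%:R.

Lemma norm_average u M n : (forall i, `|u i| <= M) -> `|average u n| <= M.
Proof.
move=> uM; have M0 : 0 <= M by exact: le_trans (uM 0%N).
case: n => [|n]; first by rewrite /average big_ord0 mul0r normr0.
rewrite /average normrM normfV [`|n.+1%:R|]ger0_norm// ler_pdivrMr//.
apply: le_trans (ler_norm_sum _ _ _) _; rewrite mulr_natr -[X in _ *+ X]card_ord.
by rewrite -sumr_const; exact: ler_sum.
Qed.

Lemma averageN u n : average (fun i => - u i) n = - average u n.
Proof. by rewrite /average sumrN mulNr. Qed.

Lemma cvg_bounded_div (u : nat -> R) C : (forall n, `|u n| <= C) ->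
  (fun n => u n / n%:R) @ \oo --> (0 : R).
Proof.
move=> uC; have C0 : 0 <= C by exact: le_trans (uC 0%N).
apply/cvgrPdist_lt => e e0; near=> n.
have n0 : 0 < n%:R :> R by rewrite ltr0n; near: n; exists 1%N.
rewrite sub0r normrN normrM normfV [`|n%:R|]ger0_norm ?ltW// ltr_pdivrMr//.
apply: le_lt_trans (uC n) _; rewrite mulrC -ltr_pdivrMr//.
near: n; exact: nbhs_infty_gtr.
Unshelve. all: end_near. Qed.

(** The two sums differ by the end terms [u n - u 0] only, which division by [n] makes
    negligible. *)
Lemma average_shift u M : (forall i, `|u i| <= M) ->
  (fun n => average (fun i => u i.+1) n - average u n) @ \oo --> (0 : R).
Proof.
move=> uM; apply: cvg_trans (cvg_bounded_div (u := fun n => u n - u 0%N) (C := M + M) _).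
  apply: near_eq_cvg; apply: nearW => n; rewrite /average -mulrBl; congr (_ / _).
  have h1 : \sum_(i < n.+1) u i = u 0%N + \sum_(i < n) u i.+1 by rewrite big_ord_recl.
  have h2 : \sum_(i < n.+1) u i = \sum_(i < n) u i + u n by rewrite big_ord_recr.
  by lra.
by move=> n; apply: le_trans (ler_normB _ _) _; exact: lerD.
Qed.

Section Map.
Variable S : T -> T.
Hypothesis mS : measurable_fun setT S.
Hypothesis PS : forall A, measurable A -> P (S @^-1` A) = P A.

Lemma measurable_iter i : measurable_fun setT (iter i S).
Proof. by elim: i => [|i IH]; [exact: measurable_id|exact: measurableT_comp]. Qed.

Lemma int_iter f i : bmeas f -> E (fun x => f (iter i S x)) = E f.
Proof.
move=> bf; elim: i => // i <-.
rewrite -(int_comp mS PS (bmeas_comp (measurable_iter i) bf)).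
by apply: eq_Rintegral => x _; rewrite -iterSr.
Qed.

Let avg f n x := average (fun i => f (iter i S x)) n.

Lemma bmeas_average f n : bmeas f -> bmeas (fun x => avg f n x).
Proof.
move=> bf; rewrite /avg /average; under eq_fun do rewrite mulrC.
by apply/bmeasZ/bmeas_sum => i; exact: bmeas_comp (measurable_iter i) bf.
Qed.

Let lsup f x := limn_sup (fun n => avg f n x).

Lemma bmeas_lsup f : bmeas f -> bmeas (lsup f).
Proof.
move=> bf; have [_ [M fM]] := bf.
apply: (bmeas_limn_sup (M := M)) => n; first by case: (bmeas_average n bf).
by move=> x; exact: norm_average.
Qed.

Lemma lsup_iter f i x : bmeas f -> lsup f (iter i S x) = lsup f x.
Proof.
move=> [_ [M fM]]; elim: i => //= i <-.
apply: (eq_limn_sup_cvg0 (M := M)) => [n|n|]; [exact: norm_average..|].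
under eq_fun do rewrite /avg.
have := average_shift (u := fun j => f (iter j S (iter i S x))) (fun=> fM _).
by apply: cvg_trans; apply: near_eq_cvg; apply: nearW => n;
   rewrite /average; under [in RHS]eq_bigr do rewrite -iterSr.
Qed.

(* After Keane and Petersen: off the set [bad K], from any point some block of
   length at most K has average at least [lsup f - e]; on [bad K], whose measure
   vanishes as K grows, f is replaced by its upper bound M.  Orbits are then
   tiled by good blocks. *)
Lemma int_lsup_le f : bmeas f -> E (lsup f) <= E f.
Proof.
move=> bf; have [_ [M fM]] := bf; have blf := bmeas_lsup bf.
have M0 : 0 <= M by exact: le_trans (fM point).
have lM x : `|lsup f x| <= M by apply: norm_limn_sup => n; exact: norm_average.
apply/ler_addgt0Pr => e e0.
pose bad K := \bigcap_(m in [set m | (0 < m <= K)%N])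
  [set x | avg f m x < lsup f x - e].
have mbad K : measurable (bad K).
  apply: bigcap_measurableType => m _.
  rewrite (_ : [set x | _] = (fun x => avg f m x - lsup f x) @^-1` `]-oo, (- e)[).
    rewrite -[X in measurable X]setTI.
    have [mm _] := bmeasB (bmeas_average m bf) blf; apply: mm => //.
  by apply/seteqP; split => x /=; rewrite in_itv /=; lra.
pose f' K x := \1_(bad K) x * (M - f x) + f x.
have fleM x : f x <= M by exact: le_trans (ler_norm _) (fM x).
have f'_ge K x : f x <= f' K x.
  by rewrite lerDr mulr_ge0 ?subr_ge0 // indicE.
have f'M K x : `|f' K x| <= M.
  rewrite /f' indicE; case: (x \in _); rewrite ?mul1r ?mul0r ?add0r//.
  by rewrite subrK ger0_norm.
have bf' K : bmeas (f' K).
  apply: bmeasD => //; apply: bmeasM; first exact: bmeas_indic.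
  by apply: bmeasB => //; exact: bmeas_cst.
have cvgf' : (fun K => E (f' K)) @ \oo --> E f.
  apply: (bounded_cvg_int (M := M)) => //; first by move=> n; case: (bf' n).
  apply: aeW => x; apply: cvg_near_cst.
  have /lt_limn_supP : lsup f x - e < lsup f x by rewrite ltrBlDr ltrDl.
  move=> /(_ M (fun n => norm_average _ (fun=> fM _)) 1%N)[m m1 hm].
  exists m => // K /= mK; rewrite /f' indicE memNset ?mul0r ?add0r //.
  move=> /(_ m); rewrite /= m1 mK => /(_ isT).
  by rewrite ltNge (ltW hm).
(* The tiling inequality along an orbit segment of length [L] is integrated. By invariance each term
   contributes the same integral, so the single loss [2 * K * M] is divided by [L]; [main2] then
   lets [L] grow. *)
have main K L : (0 < K)%N -> (0 < L)%N ->
    E (lsup f) - e - 2 * K%:R * M / L%:R <= E (f' K).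
  move=> K0 L0; have LR : 0 < L%:R :> R by rewrite ltr0n.
  suff : L%:R * (E (lsup f) - e) - 2 * K%:R * M <= L%:R * E (f' K).
    move=> h; rewrite -(ler_pM2l LR) mulrBr.
    rewrite (_ : L%:R * (2 * K%:R * M / L%:R) = 2 * K%:R * M) //.
    by field; rewrite gt_eqF.
  have -> : L%:R * E (f' K) = E (fun x => \sum_(i < L) f' K (iter i S x)).
    rewrite int_sum; last by move=> i; exact: bmeas_comp (measurable_iter i) (bf' K).
    under eq_bigr do rewrite int_iter//.
    by rewrite sumr_const card_ord mulr_natl.
  have -> : L%:R * (E (lsup f) - e) - 2 * K%:R * M =
      E (fun x => L%:R * (lsup f x - e) - 2 * K%:R * M).
    rewrite intB ?int_cst ?intZ ?intB ?int_cst//; try exact: bmeas_cst.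
    - by apply: bmeasB => //; exact: bmeas_cst.
    - by apply/bmeasZ/bmeasB => //; exact: bmeas_cst.
  apply: le_int.
  - by apply: bmeasB; [apply/bmeasZ/bmeasB => //|]; exact: bmeas_cst.
  - by apply: bmeas_sum => i; exact: bmeas_comp (measurable_iter i) (bf' K).
  move=> x.
  have := @greedy_sum_ge R (fun j => f' K (iter j S x)) M (lsup f x - e) K.
  move=> /(_ (fun=> f'M _ _)); rewrite -(big_mkord xpredT (fun j => f' K (iter j S x))).
  move=> h; have := h _ _ L 0%N; rewrite add0n; apply.
    by rewrite lerBlDr (le_trans (ler_norm _))// (le_trans (lM x))// lerDl ltW.
  move=> i; set y := iter i S x.
  have sumE m : \sum_(i <= j < i + m) f' K (iter j S x) =
      \sum_(j < m) f' K (iter j S y).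
    rewrite -{1}[i]add0n (big_addn 0%N (i + m) i xpredT) addKn big_mkord.
    by apply: eq_bigr => j _; rewrite iterD.
  (* A bad point is by itself a good block of length one: there [f'] equals [M], which dominates
     [lsup f]. *)
  have [ybad|] := pselect (bad K y).
    exists 1%N; split => //; rewrite sumE big_ord1 /= mul1r /f' indicE mem_set//.
    rewrite mul1r subrK lerBlDr (le_trans (ler_norm _))// (le_trans (lM x))//.
    by rewrite lerDl ltW.
  move=> /existsNP[m /not_implyP[/= /andP[m0 mK] /negP]]; rewrite -leNgt => hm.
  exists m; split => //; rewrite sumE mulrC -ler_pdivlMr ?ltr0n//.
  rewrite -(lsup_iter i x bf); apply: le_trans hm _.
  rewrite /avg /average ler_pM2r ?invr_gt0 ?ltr0n//.
  exact: ler_sum.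
have main2 K : (0 < K)%N -> E (lsup f) - e <= E (f' K).
  move=> K0; apply/ler_addgt0Pr => a a0.
  have KM0 : 0 <= 2 * K%:R * M / a by rewrite divr_ge0 ?mulr_ge0 // ltW.
  set L := (Num.bound (2 * K%:R * M / a)).+1.
  have := main K L K0 isT; rewrite lerBlDr => /le_trans; apply.
  rewrite lerD2l ler_pdivrMr ?ltr0n// [a * _]mulrC -ler_pdivrMr//.
  by apply: ltW; apply: lt_le_trans (archi_boundP KM0) _; rewrite ler_nat.
rewrite -lerBlDr; apply: (cvgr_to_ge cvgf').
by exists 1%N => // K /=; exact: main2.
Qed.

(** [int_lsup_le] for [f] and for [- f] bounds the integral of upper limit minus lower limit by 0.
    This difference is nonnegative, so it vanishes almost everywhere. *)
Theorem birkhoff f : bmeas f -> exists g, [/\ bmeas g, E g = E f &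
  {ae P, forall x, (fun n => average (fun i => f (iter i S x)) n) @ \oo --> g x}].
Proof.
move=> bf; have [_ [M fM]] := bf; have bNf := bmeasN bf.
have blf := bmeas_lsup bf; have blNf := bmeas_lsup bNf.
have NfE x : lsup (fun x => - f x) x = limn_sup (fun n => - avg f n x).
  by congr limn_sup; apply/funext => n; rewrite -averageN.
have aM x n : `|avg f n x| <= M by exact: norm_average.
have sum_ge0 x : 0 <= lsup f x + lsup (fun x => - f x) x.
  by rewrite NfE; exact: limn_sup_addN_ge0 (aM x).
have le1 := int_lsup_le bf; have le2 := int_lsup_le bNf; rewrite intN// in le2.
have bs := bmeasD blf blNf.
have intge0 : 0 <= E (fun x => lsup f x + lsup (fun x => - f x) x).
  exact: Rintegral_ge0.
exists (lsup f); split => //.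
  by move: intge0; rewrite intD//; lra.
have : {ae P, forall x, lsup f x + lsup (fun x => - f x) x = 0}.
  by apply: ae_eq0_int => //; rewrite intD//; lra.
apply: filterS => x; rewrite NfE => x0.
by apply: (cvg_limn_supN (aM x)); rewrite x0.
Qed.

End Map.
End Birkhoff.

(** * Integrals of functions related almost everywhere *)

Section AlmostEverywhere.
Context d (T : measurableType d) (R : realType) (P : probability T R).
Implicit Types f g : T -> R.

Lemma int_ae_eq f g : bmeas f -> bmeas g -> {ae P, forall x, f x = g x} ->
  \int[P]_x f x = \int[P]_x g x.
Proof.
move=> [mf _] [mg _] fg; congr fine; apply: ae_eq_integral => //.
- exact/measurable_EFinP.
- exact/measurable_EFinP.
- by apply: filterS fg => x /= -> _.
Qed.

Lemma le_int_ae f g : bmeas f -> bmeas g -> {ae P, forall x, f x <= g x} ->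
  \int[P]_x f x <= \int[P]_x g x.
Proof.
move=> bf bg fg; have [mf [M fM]] := bf; have [mg [N gN]] := bg.
(* [f \min g] equals [f] almost everywhere and is at most [g] everywhere, which reduces the claim to
   [le_int]. *)
have bm : bmeas (f \min g).
  split; first exact: measurable_minr.
  exists (M + N) => x /=; have := fM x; have := gN x.
  by rewrite minEle; case: ifP => _; have := normr_ge0 (f x); have := normr_ge0 (g x); lra.
rewrite (@int_ae_eq f (f \min g))//.
  by apply: le_int => // x; rewrite ge_min lexx orbT.
by apply: filterS fg => x fgx; rewrite /= min_l.
Qed.

End AlmostEverywhere.

(** * Half-open boxes of integer points *)

Lemma sumr_const_seq (V : nmodType) (I : Type) (s : seq I) (x : V) :
  \sum_(i <- s) x = x *+ size s.
Proof. by rewrite big_const_seq count_predT iter_addr_0. Qed.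

(** The interval from [-n] to [n-1], split into its nonnegative and negative halves because each
    half is a one-sided orbit, to which Birkhoff's theorem applies. *)
Definition int_range (n : nat) : seq int :=
  [seq Posz i | i <- iota 0 n] ++ [seq Negz i | i <- iota 0 n].

Lemma mem_int_range n k : (k \in int_range n) = (- n%:Z <= k < n%:Z).
Proof.
rewrite mem_cat; case: k => k.
  rewrite mem_map => [|? ? []//]; rewrite mem_iota.
  have -> : (Posz k \in [seq Negz i | i <- iota 0 n]) = false.
    by apply/negP => /mapP[].
  by rewrite orbF; lia.
rewrite [X in _ || X]mem_map => [|? ? []//]; rewrite mem_iota.
have -> : (Negz k \in [seq Posz i | i <- iota 0 n]) = false.
  by apply/negP => /mapP[].
by lia.
Qed.

Lemma int_range_uniq n : uniq (int_range n).
Proof.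
rewrite cat_uniq !map_inj_uniq ?iota_uniq ?andbT /=; [|by move=> ? ? []..].
by apply/hasPn => _ /mapP[i _ ->]; apply/negP => /mapP[].
Qed.

Lemma big_int_range (V : zmodType) (F : int -> V) n :
  \sum_(k <- int_range n) F k = \sum_(i < n) (F (Posz i) + F (Negz i)).
Proof.
rewrite /int_range big_cat !big_map big_split /=.
by rewrite -[X in iota 0 X]subn0 -!/(index_iota 0 n) !big_mkord.
Qed.

Lemma telescope_int_range (V : zmodType) (h : int -> V) n :
  \sum_(k <- int_range n) (h (k + 1) - h k) = h n - h (- n%:Z).
Proof.
rewrite big_int_range; elim: n => [|n IH]; first by rewrite big_ord0 oppr0 subrr.
rewrite big_ord_recr IH /=.
have -> : Posz n + 1 = n.+1 :> int by lia.
have -> : Negz n + 1 = - n%:Z by lia.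
by rewrite NegzE addrACA addKr [h n + _]addrC subrK.
Qed.

Section Boxes.
Variable d : nat.
Implicit Types (js : seq 'I_d) (v : {ffun 'I_d -> int}).

Definition axis (j : 'I_d) (k : int) : {ffun 'I_d -> int} :=
  [ffun i => if i == j then k else 0].

(** The recursion is on a list of axes inside a fixed ['I_d], so that averages along only some of
    the axes still act on the same space. *)
Fixpoint box (n : nat) (js : seq 'I_d) : seq {ffun 'I_d -> int} :=
  if js is j :: js' then [seq axis j k + v | k <- int_range n, v <- box n js']
  else [:: 0].

Lemma axisD j k l : axis j (k + l) = axis j k + axis j l.
Proof. by apply/ffunP => i; rewrite !ffunE; case: ifP; rewrite ?addr0. Qed.

Lemma axis0 j : axis j 0 = 0.
Proof. by apply/ffunP => i; rewrite !ffunE; case: ifP. Qed.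

Lemma size_box n js : size (box n js) = ((2 * n) ^ size js)%N.
Proof.
elim: js => //= j js IH; rewrite size_allpairs IH expnS size_cat !size_map.
by rewrite size_iota addnn -mul2n.
Qed.

Lemma mem_box n js v : uniq js ->
  (v \in box n js) =
  [forall i, if i \in js then - n%:Z <= v i < n%:Z else v i == 0].
Proof.
elim: js v => [|j js IH] v /=.
  rewrite inE => _; apply/eqP/forallP => [-> i|h]; first by rewrite ffunE.
  by apply/ffunP => i; rewrite ffunE; apply/eqP; have := h i.
move=> /andP[jjs ujs]; apply/allpairsP/forallP => [[[k u]]|h] /=.
  move=> [kn]; rewrite IH// => /forallP un -> i; rewrite inE !ffunE.
  have := un i; have [->|] := eqVneq i j => /=.
    by rewrite (negPf jjs) => /eqP ->; rewrite addr0 -mem_int_range.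
  by rewrite add0r.
exists (v j, [ffun i => if i == j then 0 else v i]); split => /=.
- by have := h j; rewrite mem_head mem_int_range.
- rewrite IH//; apply/forallP => i; rewrite ffunE; have := h i; rewrite inE.
  have [->|ij] := eqVneq i j => //=; by rewrite (negPf jjs).
- apply/ffunP => i; rewrite !ffunE; case: ifP => [/eqP ->|_];
  by rewrite ?addr0 ?add0r.
Qed.

Lemma box_uniq n js : uniq js -> uniq (box n js).
Proof.
elim: js => //= j js IH /andP[jjs ujs].
apply: allpairs_uniq; [exact: int_range_uniq|exact: IH|].
move=> [k u] [l v] /allpairsP[[k' u'] /= [_ hu [-> ->]]].
move=> /allpairsP[[l' v'] /= [_ hv [-> ->]]] e.
have u0 : u' j = 0.
  by move: hu; rewrite mem_box// => /forallP/(_ j); rewrite (negPf jjs) => /eqP.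
have v0 : v' j = 0.
  by move: hv; rewrite mem_box// => /forallP/(_ j); rewrite (negPf jjs) => /eqP.
have kl : k' = l'.
  by move/ffunP/(_ j): e; rewrite !ffunE eqxx u0 v0 !addr0.
by move: e; rewrite kl => /addrI ->.
Qed.

End Boxes.

(** * The multiparameter ergodic theorem *)

Section MultiparameterErgodic.
Context d0 (T : measurableType d0) (R : realType) (P : probability T R).
Variables (d : nat) (a : {ffun 'I_d -> int} -> T -> T).
Hypothesis a0 : forall x, a 0 x = x.
Hypothesis aD : forall u v x, a (u + v) x = a u (a v x).
Hypothesis ma : forall v, measurable_fun setT (a v).
Hypothesis Pa : forall v A, measurable A -> P (a v @^-1` A) = P A.
Local Notation E f := (\int[P]_x f x).

Definition axis_mean (j : 'I_d) (h : T -> R) (n : nat) (x : T) : R :=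
  (\sum_(k <- int_range n) h (a (axis j k) x)) / (2 * n)%:R.

Definition box_mean (js : seq 'I_d) (f : T -> R) (n : nat) (x : T) : R :=
  (\sum_(v <- box n js) f (a v x)) / (2 * n)%:R ^+ size js.

Lemma box_mean_cons j js f n x :
  box_mean (j :: js) f n x = axis_mean j (box_mean js f n) n x.
Proof.
rewrite /box_mean /axis_mean big_allpairs_dep /= -mulr_suml -mulrA -invfM -exprSr.
congr (_ / _); apply: eq_bigr => k _.
by apply: eq_bigr => v _; rewrite addrC aD.
Qed.

(** [Negz i] is [- (i + 1)], one step further than [i] backward iterations; hence the extra
    [a (axis j (-1))] in the second average. *)
Lemma axis_meanE j h n x : axis_mean j h n x =
  (average (fun i => h (iter i (a (axis j 1)) x)) n +
   average (fun i => h (a (axis j (-1)) (iter i (a (axis j (-1))) x))) n) / 2.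
Proof.
have itp i : iter i (a (axis j 1)) x = a (axis j i%:Z) x.
  elim: i => /= [|i ->]; first by rewrite axis0 a0.
  by rewrite -aD -axisD.
have itn i : iter i (a (axis j (-1))) x = a (axis j (- i%:Z)) x.
  elim: i => /= [|i ->]; first by rewrite oppr0 axis0 a0.
  by rewrite -aD -axisD; congr (a (axis j _) x); lia.
rewrite /axis_mean big_int_range /average -mulrDl -big_split /= natrM invfM mulrA.
rewrite [RHS]mulrAC; congr (_ / _); congr (_ / _); apply: eq_bigr => i _.
rewrite itp itn -aD -axisD; congr (_ + h (a (axis j _) x)); lia.
Qed.

Lemma axis_mean_ergodic j h : bmeas h -> exists g, [/\ bmeas g, E g = E h &
  {ae P, forall x, (fun n => axis_mean j h n x) @ \oo --> g x}].
Proof.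
move=> bh; have [g1 [bg1 Eg1 cg1]] := birkhoff (ma (axis j 1)) (Pa (axis j 1)) bh.
have bh' := bmeas_comp (ma (axis j (-1))) bh.
have [g2 [bg2 Eg2 cg2]] := birkhoff (ma (axis j (-1))) (Pa (axis j (-1))) bh'.
exists (fun x => 2^-1 * (g1 x + g2 x)); split.
- exact/bmeasZ/bmeasD.
- rewrite intZ ?intD//; last exact: bmeasD.
  rewrite Eg1 Eg2 (int_comp (ma (axis j (-1))) (Pa (axis j (-1))) bh).
  by field.
- apply: filterS2 cg1 cg2 => x c1 c2.
  under eq_fun do rewrite axis_meanE mulrC.
  by apply: cvgM; [exact: cvg_cst|exact: cvgD].
Qed.

Lemma norm_axis_mean j h M n x : (forall x, `|h x| <= M) ->
  `|axis_mean j h n x| <= M.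
Proof.
move=> hM; rewrite axis_meanE normrM [`|2^-1|]ger0_norm// ler_pdivrMr//.
apply: le_trans (ler_normD _ _) _.
by rewrite mulr_natr mulr2n; apply: lerD; apply: norm_average.
Qed.

Lemma norm_box_mean js f M n x : (forall x, `|f x| <= M) ->
  `|box_mean js f n x| <= M.
Proof.
move=> fM; elim: js x => [|j js IH] x; last by rewrite box_mean_cons norm_axis_mean.
by rewrite /box_mean /= big_seq1 expr0 divr1.
Qed.

Lemma bmeas_box_mean js f n : bmeas f -> bmeas (box_mean js f n).
Proof.
move=> bf; rewrite (_ : box_mean js f n = fun x =>
  ((2 * n)%:R ^+ size js)^-1 * \sum_(v <- box n js) f (a v x)).
  by apply/bmeasZ/bmeas_sum => v; exact: bmeas_comp.
by apply/funext => x; rewrite mulrC.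
Qed.

Lemma axis_mean_le j h h' n x : (forall x, h x <= h' x) ->
  axis_mean j h n x <= axis_mean j h' n x.
Proof. by move=> hh'; rewrite ler_wpM2r ?invr_ge0//; exact: ler_sum. Qed.

Lemma axis_meanB j h h' n x :
  axis_mean j h n x - axis_mean j h' n x = axis_mean j (fun x => h x - h' x) n x.
Proof. by rewrite -mulrBl -sumrB. Qed.

Lemma ler_norm_axis_mean j h n x :
  `|axis_mean j h n x| <= axis_mean j (fun x => `|h x|) n x.
Proof.
rewrite normrM normfV [`|(2 * n)%:R|]ger0_norm// ler_wpM2r ?invr_ge0//.
exact: ler_norm_sum.
Qed.

Lemma measurable_axis_mean j h n : bmeas h -> bmeas (axis_mean j h n).
Proof.
move=> bh; rewrite (_ : axis_mean j h n = fun x =>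
  (2 * n)%:R^-1 * \sum_(k <- int_range n) h (a (axis j k) x)).
  by apply/bmeasZ/bmeas_sum => k; exact: bmeas_comp.
by apply/funext => x; rewrite mulrC.
Qed.

(* Dunford's iteration: the error in the inner averages is dominated by its
   tail supremum D N, whose outer averages converge to a function with the
   same integral, and these integrals vanish as N grows. *)
Lemma box_mean_cvg js f : bmeas f -> exists g, [/\ bmeas g, E g = E f &
  {ae P, forall x, (fun n => box_mean js f n x) @ \oo --> g x}].
Proof.
move=> bf; have [_ [M fM]] := bf; elim: js => [|j js [g1 [bg1 Eg1 cg1]]].
  exists f; split => //; apply: aeW => x; rewrite /box_mean /=.
  by under eq_fun do rewrite big_seq1 a0 expr0 divr1; exact: cvg_cst.
have [g [bg Eg cg]] := axis_mean_ergodic j bg1.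
exists g; split; [by []|by rewrite Eg|].
have [_ [M1 gM1]] := bg1.
pose D0 n x := `|box_mean js f n x - g1 x|.
have D0M n x : `|D0 n x| <= M + M1.
  rewrite /D0 normr_id; apply: le_trans (ler_normB _ _) _.
  by apply: lerD => //; exact: norm_box_mean.
have bD0 n : bmeas (D0 n) by apply/bmeas_norm/bmeasB => //; exact: bmeas_box_mean.
have ubD0 x : has_ubound (range (D0 ^~ x)).
  exact: bounded_fun_has_ubound (bounded_seqP (D0M ^~ x)).
pose D N x := sups (D0 ^~ x) N.
have D_ge N n x : (N <= n)%N -> D0 n x <= D N x.
  by move=> Nn; apply: ub_le_sup; [exact: has_ubound_sdrop|exists n].
have D_M N x : `|D N x| <= M + M1.
  have D_ge0 : 0 <= D N x by apply: le_trans (D_ge N N x (leqnn _)); rewrite /D0.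
  rewrite ger0_norm//; apply: ge_sup; first by exists (D0 N x); exists N => /=.
  by move=> _ [n /= _ <-]; exact: le_trans (ler_norm _) (D0M n x).
have mD N : measurable_fun setT (D N).
  by apply: measurable_fun_sups => // n; case: (bD0 n).
have bD N : bmeas (D N) by split => //; exists (M + M1).
have cvgD : (fun N => E (D N)) @ \oo --> 0.
  rewrite -(int_cst P 0); apply: (bounded_cvg_int (M := M + M1)) => //.
    exact: bmeas_cst.
  apply: filterS cg1 => x cx; apply: (@cvg_sups R (D0 ^~ x) 0).
  rewrite -(normr0 R) -(subrr (g1 x)); apply: cvg_norm.
  by apply: cvgB => //; exact: cvg_cst.
(* The inner mean changes with the same [n] as the outer one, so its convergence at almost every
   point does not pass directly through the outer mean. Only the upper limit [W] of the resulting
   error is controlled. *)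
pose w n x := `|axis_mean j (box_mean js f n) n x - axis_mean j g1 n x|.
have wM n x : `|w n x| <= M + M1.
  rewrite /w normr_id axis_meanB; apply: norm_axis_mean => y.
  by have := D0M n y; rewrite /D0 normr_id.
have bw n : bmeas (w n).
  by apply/bmeas_norm/bmeasB; apply: measurable_axis_mean => //; exact: bmeas_box_mean.
pose W x := limn_sup (w ^~ x).
have bW : bmeas W.
  by apply: (bmeas_limn_sup (M := M + M1)) => // n; case: (bw n).
have W0 x : 0 <= W x.
  rewrite leNgt; apply/negP => /(limn_sup_ltP (wM ^~ x))[N /(_ N (leqnn _))].
  by rewrite ltNge /w normr_ge0.
have W_le N : E W <= E (D N).
  have [e [be Ee ce]] := axis_mean_ergodic j (bD N).
  rewrite -Ee; apply: le_int_ae => //; apply: filterS ce => x cx.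
  rewrite leNgt; apply/negP => lt_eW; have [m /andP[em mW]] : exists m, e x < m < W x.
    by exists ((e x + W x) / 2); lra.
  have [K _ KP] := cvgr_lt _ cx _ em.
  have [n] := lt_limn_supP (wM ^~ x) mW (maxn K N).
  rewrite geq_max => /andP[Kn Nn] mw; have := KP n Kn; apply/negP; rewrite -leNgt.
  apply: ltW (lt_le_trans mw _); rewrite /w axis_meanB.
  apply: le_trans (ler_norm_axis_mean _ _ _ _) _.
  by apply: axis_mean_le => y; exact: D_ge.
have EW : E W <= 0 by apply: (cvgr_to_ge cvgD); exact: nearW.
have := ae_eq0_int bW W0 EW; apply: filterS2 cg => x cx Wx.
under eq_fun do rewrite box_mean_cons.
apply: (cvg_sub0 _ cx); apply/cvgrPdist_lt => e e0.
have /(limn_sup_ltP (wM ^~ x))[N NP] : W x < e by rewrite Wx.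
by exists N => // n /NP; rewrite /w /= sub0r normrN.
Qed.

(** A box and its translate by one step along [j] differ in two opposite faces of
    [(2 * n) ^ (size js).-1] points each: the sum telescopes along [j], and the other axes only
    multiply the bound. *)
Lemma box_sum_axis js (f : T -> R) (M : R) n x j : (forall x, `|f x| <= M) -> j \in js ->
  `|\sum_(v <- box n js) f (a v (a (axis j 1) x)) -
    \sum_(v <- box n js) f (a v x)| <= 2 * M * (2 * n)%:R ^+ (size js).-1.
Proof.
move=> fM; elim: js x => //= i js IH x; rewrite inE !big_allpairs_dep /=.
have [<- _|_ /= jjs] := eqVneq j i.
  rewrite exchange_big [X in _ - X]exchange_big -sumrB /=.
  rewrite -natrX -size_box mulr_natr; apply: le_trans (ler_norm_sum _ _ _) _.
  rewrite -sumr_const_seq.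
  apply: ler_sum => v _; rewrite -sumrB.
  pose h k := f (a v (a (axis j k) x)).
  rewrite (_ : \sum_(k <- _) _ = \sum_(k <- int_range n) (h (k + 1) - h k)).
    rewrite telescope_int_range; apply: le_trans (ler_normB _ _) _.
    by rewrite mulr_natl mulr2n; apply: lerD; exact: fM.
  apply: eq_bigr => k _; rewrite /h -!aD; congr (f (a _ x) - f (a _ x)).
    by rewrite [_ + v]addrC -addrA -axisD.
  by rewrite addrC.
rewrite -sumrB; apply: le_trans (ler_norm_sum _ _ _) _.
have -> : 2 * M * (2 * n)%:R ^+ size js =
    \sum_(k <- int_range n) (2 * M * (2 * n)%:R ^+ (size js).-1).
  rewrite sumr_const_seq size_cat !size_map size_iota addnn -mul2n.
  by case: js jjs {IH} => // ? ? _ /=; rewrite -mulrnAr -[_ ^+ _ *+ _]mulr_natr -exprSr.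
apply: ler_sum => k _; have := IH (a (axis i k) x) jjs.
rewrite -aD [axis j 1 + _]addrC aD.
by under eq_bigr do rewrite -aD addrC; under [X in _ - X]eq_bigr do rewrite -aD addrC.
Qed.

(** Ergodicity speaks of strictly invariant sets, whereas the limit [g] is known almost everywhere
    only. The upper limit [G] is defined everywhere, is strictly invariant and equals [g] almost
    everywhere. *)
Theorem box_mean_ergodic (f : T -> R) : bmeas f ->
  (forall A, measurable A -> (forall v, a v @^-1` A = A) -> P A = 0%E \/ P A = 1%E) ->
  {ae P, forall x, (fun n => box_mean (enum 'I_d) f n x) @ \oo --> E f}.
Proof.
move=> bf erg; have [_ [M fM]] := bf.
have [g [bg Eg cg]] := box_mean_cvg (enum 'I_d) bf.
pose G x := limn_sup (fun n => box_mean (enum 'I_d) f n x).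
have mM x n : `|box_mean (enum 'I_d) f n x| <= M by exact: norm_box_mean.
have bG : bmeas G.
  by apply: (bmeas_limn_sup (M := M)) => // n; case: (bmeas_box_mean (enum 'I_d) n bf).
have Gg : {ae P, forall x, G x = g x}.
  by apply: filterS cg => x cx; exact: (cvg_limn_inf_sup cx).2.
pose inv v := forall x, G (a v x) = G x.
have invD u v : inv u -> inv v -> inv (u + v) by move=> iu iv x; rewrite aD iu iv.
have invN v : inv v -> inv (- v) by move=> iv x; rewrite -iv -aD subrr a0.
have inv_axis j : inv (axis j 1).
  move=> x; apply: (eq_limn_sup_cvg0 (mM _) (mM _)).
  (* By [box_sum_axis] the two means differ by at most [2 * M * (2 * n) ^ (d - 1) / (2 * n) ^ d],
     that is [M / n]; so [n] times the difference is bounded by [M]. *)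
  have := @cvg_bounded_div R (fun n => (box_mean (enum 'I_d) f n (a (axis j 1) x)
    - box_mean (enum 'I_d) f n x) * n%:R) M.
  have M0 : 0 <= M by exact: le_trans (fM x).
  move=> h; apply: cvg_trans (h _) => {h}.
    apply: near_eq_cvg; exists 1%N => // n /= n1; rewrite mulfK//.
    by rewrite pnatr_eq0 -lt0n.
  move=> n; have dm : size (enum 'I_d) = (size (enum 'I_d)).-1.+1.
    by rewrite size_enum_ord; case: (d) (j) => // -[].
  case: n => [|n]; first by rewrite mulr0 normr0.
  rewrite normrM [`|n.+1%:R|]ger0_norm// -mulrBl normrM normfV.
  rewrite [`|_ ^+ _|]ger0_norm ?exprn_ge0// dm exprSr invfM mulrA natrM.
  rewrite invfM mulrA divfK; last by rewrite pnatr_eq0.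
  rewrite !ler_pdivrMr ?exprn_gt0 ?mulr_gt0//.
  have := @box_sum_axis (enum 'I_d) f M n.+1 x j fM (mem_enum _ _).
  by rewrite natrM; congr (_ <= _); ring.
(* The unit steps along the axes generate all translations. *)
have invA v : inv v.
  have inv0 : inv 0 by move=> x; rewrite a0.
  have -> : v = \sum_j axis j (v j).
    apply/ffunP => i; rewrite sum_ffunE (bigD1 i)//= ffunE eqxx big1 ?addr0//.
    by move=> j ji; rewrite ffunE eq_sym (negPf ji).
  elim/big_ind : _ => // j _; elim: (v j) => [|k IH|k IH]; first by rewrite axis0.
    by rewrite -addn1 PoszD axisD; exact: invD.
  rewrite -addn1 PoszD opprD axisD; apply: invD => //.
  rewrite (_ : axis j (- 1) = - axis j 1); first exact: invN.
  by apply/ffunP => i; rewrite !ffunE; case: ifP; rewrite ?oppr0.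
set m := E f; have EG : E G = m by rewrite /m -Eg; exact: int_ae_eq.
have bGm : bmeas (fun x => G x - m) by apply: bmeasB => //; exact: bmeas_cst.
have bn := bmeas_norm bGm.
have EGm : E (fun x => G x - m) = 0.
  by rewrite intB// ?int_cst ?EG ?subrr//; exact: bmeas_cst.
(* The set where [G < m] has probability 0 or 1, so [G - m] has a constant sign almost surely. The
   integral of its absolute value is then plus or minus its mean, which is 0. *)
have En : E (fun x => `|G x - m|) = 0.
  pose A := [set x | G x < m].
  have mA : measurable A.
    rewrite (_ : A = (fun x => G x - m) @^-1` `]-oo, 0[).
      by rewrite -[X in measurable X]setTI; have [mm _] := bGm; apply: mm.
    by apply/seteqP; split => x; rewrite /A /= in_itv /= subr_lt0.
  have [|A0|A1] := erg A mA.
  - by move=> v; apply/seteqP; split => x; rewrite /A /= invA.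
  - rewrite -EGm; apply: int_ae_eq => //.
    have : P.-negligible A by exact/negligibleP.
    apply: negligibleS => x /= h; rewrite /A /= ltNge; apply/negP => mG.
    by apply: h; rewrite ger0_norm// subr_ge0.
  - rewrite -[RHS]oppr0 -EGm -intN//; apply: int_ae_eq => //; first exact: bmeasN.
    have : P.-negligible (~` A).
      apply/negligibleP; first exact: measurableC.
      by rewrite [LHS]probability_setC// [X in (_ - X)%E]A1 subee.
    apply: negligibleS => x /= h Ax; apply: h.
    by rewrite ler0_norm// subr_le0 ltW.
have En0 : E (fun x => `|G x - m|) <= 0 by rewrite En.
have Gm := ae_eq0_int bn (fun x => normr_ge0 _) En0.
apply: filterS3 cg Gg Gm => x cx Gx /eqP; rewrite normr_eq0 subr_eq0 Gx => /eqP <-.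
exact: cx.
Qed.

End MultiparameterErgodic.

(** * Rank as a number of leading positions *)

Section LeadingPositions.
Variable F : fieldType.

Definition leads n (u : 'rV[F]_n) (i : 'I_n) :=
  (u 0 i != 0) && [forall j : 'I_n, (i < j)%N ==> (u 0 j == 0)].

(** The row space is filtered by the vectors supported on the first [k] positions. Each step raises
    the dimension by at most one, and does so exactly when position [k] leads some vector. *)
Lemma mxrank_leads m n (U : 'M[F]_(m, n)) :
  \rank U = #|[pred i | `[< exists2 u : 'rV_n, (u <= U)%MS & leads u i >] ]|.
Proof.
(* [T k] keeps the coordinates from [k] on, so its kernel consists of the vectors supported before
   [k]. *)
pose T k : 'M[F]_n := \matrix_(i, j) ((i == j) && (k <= i)%N)%:R.
have subT k (u : 'rV_n) :
    (u <= kermx (T k))%MS = [forall j : 'I_n, (k <= j)%N ==> (u 0 j == 0)].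
  have uT j : (u *m T k) 0 j = u 0 j * (k <= j)%N%:R.
    rewrite mxE (bigD1 j)//= mxE eqxx /= big1 ?addr0// => i ij.
    by rewrite mxE (negPf ij) mulr0.
  apply/sub_kermxP/forallP => [h j|h].
    apply/implyP => kj; have := uT j.
    by rewrite h mxE kj mulr1 => <-.
  apply/rowP => j; rewrite uT mxE; have := h j; case: leqP => _ /=; last by rewrite mulr0.
  by move=> /eqP ->; rewrite mul0r.
pose W k := (U :&: kermx (T k))%MS.
pose L := [pred i | `[< exists2 u : 'rV_n, (u <= U)%MS & leads u i >] ].
have rW k : (k <= n)%N -> \rank (W k) = #|[pred i in L | (i < k)%N]|.
  elim: k => [_|k IH kn].
    rewrite eq_card0 => [|i]; last by rewrite !inE ltn0 andbF.
    apply/eqP; rewrite mxrank_eq0 -submx0; apply/rV_subP => u.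
    rewrite sub_capmx subT => /andP[_ /forallP h]; rewrite submx0; apply/eqP.
    by apply/rowP => j; rewrite mxE; have := h j => /eqP.
  (* [B] reads off coordinate [k]: on [W k.+1] its kernel is [W k], and its image has rank 0 or
     1. *)
  pose ik := Ordinal kn; pose B : 'M[F]_(n, 1) := delta_mx ik 0.
  have uB (u : 'rV_n) : (u *m B) 0 0 = u 0 ik.
    rewrite mxE (bigD1 ik)//= mxE !eqxx mulr1 big1 ?addr0// => i ij.
    by rewrite mxE (negPf ij) mulr0.
  have WB : (W k.+1 :&: kermx B :=: W k)%MS.
    apply/eqmxP/rV_eqP => u; rewrite !sub_capmx -andbA; congr (_ && _).
    rewrite !subT; apply/andP/forallP => [[/forallP h /sub_kermxP uB0] j|h].
      rewrite leq_eqVlt; apply/implyP => /predU1P[kj|]; last by have := h j => /implyP.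
      by rewrite (_ : j = ik) -?uB ?uB0 ?mxE//; exact/val_inj.
    split; first by apply/forallP => j; apply/implyP => /ltnW; exact/implyP.
    apply/sub_kermxP/rowP => j; rewrite ord1 uB mxE.
    by have := h ik; rewrite leqnn => /eqP.
  have := mxrank_mul_ker (W k.+1) B; rewrite WB IH 1?ltnW// => <-.
  have WB0 : (W k.+1 *m B != 0) = (ik \in L).
    rewrite /L inE; apply/idP/asboolP => [|[u uU /andP[uk /forallP h]]].
      move=> nz; have [i ri] : exists i, row i (W k.+1 *m B) != 0.
        apply/existsP; apply: contra_neqT nz => /existsPn h.
        by apply/row_matrixP => i; have := h i; rewrite negbK row0 => /eqP.
      exists (row i (W k.+1)).
        by have := row_sub i (W k.+1); rewrite sub_capmx => /andP[].
      apply/andP; split; last first.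
        by have := row_sub i (W k.+1); rewrite sub_capmx subT => /andP[].
      apply: contra_neq ri; rewrite row_mul => h; apply/rowP => j.
      by rewrite ord1 uB h mxE.
    have /submxP[D uD] : (u <= W k.+1)%MS.
      by rewrite sub_capmx uU subT; apply/forallP.
    apply: contraNneq uk => WB0'; rewrite -uB {1}uD -mulmxA WB0'.
    by rewrite mulmx0 mxE.
  have -> : \rank (W k.+1 *m B) = (ik \in L).
    rewrite -WB0; apply/eqP; rewrite eqn_leq; case: (eqVneq (W k.+1 *m B) 0) => /=.
      by move=> ->; rewrite mxrank0.
    by move=> nz; rewrite rank_leq_col lt0n mxrank_eq0.
  rewrite (cardD1 ik [pred i in L | (i < k.+1)%N]).
  rewrite (_ : (ik \in [pred i in L | (i < k.+1)%N]) = (ik \in L)); last first.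
    by rewrite -[LHS]/((ik \in L) && (k < k.+1)%N) ltnSn andbT.
  congr (_ + _)%N.
  apply: eq_card => i; rewrite !inE ltnS [(i <= k)%N]leq_eqVlt.
  have [->|ik'] := eqVneq i ik; first by rewrite ltnn andbF.
  rewrite /= (_ : (i == k :> nat) = false)//.
  by apply: contraNF ik' => /eqP h; exact/eqP/val_inj.
have -> : \rank U = \rank (W n).
  apply: eqmx_rank; apply/rV_eqP => u; rewrite sub_capmx subT.
  rewrite (_ : [forall j, _]) ?andbT//; apply/forallP => j; apply/implyP.
  by rewrite leqNgt ltn_ord.
by rewrite rW//; apply: eq_card => i; rewrite !inE ltn_ord andbT.
Qed.

End LeadingPositions.

Lemma clear_denominators n (u : 'I_n -> rat) :
  exists2 N : int, N != 0 & exists v : 'I_n -> int, forall j, (v j)%:~R = N%:~R * u j.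
Proof.
exists (\prod_j denq (u j)); first by apply/prodf_neq0 => j _; exact: denq_neq0.
exists (fun j => (\prod_(i | i != j) denq (u i)) * numq (u j)) => j.
rewrite [X in _ = X%:~R * _](bigD1 j)//= !rmorphM /=.
move: (denq_neq0 (u j)) (divq_num_den (u j)).
move: (denq (u j)) (numq (u j)) => b a b0 <-.
by rewrite [RHS]mulrC mulrA divfK ?intr_eq0// mulrC.
Qed.

(** Used to sum a boundary over whichever list is convenient, instead of over [coface_cands]. *)
Lemma eq_big_uniq_support (V : nmodType) (I : eqType) (s1 s2 : seq I) (F : I -> V) :
  uniq s1 -> uniq s2 -> (forall i, F i != 0 -> (i \in s1) = (i \in s2)) ->
  \sum_(i <- s1) F i = \sum_(i <- s2) F i.
Proof.
move=> u1 u2 s12; have trim s : \sum_(i <- s) F i = \sum_(i <- s | F i != 0) F i.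
  rewrite (bigID (fun i => F i != 0))/= [X in _ + X]big1 ?addr0// => i.
  by rewrite negbK => /eqP.
rewrite trim [RHS]trim -big_filter -[RHS]big_filter; apply: perm_big.
apply: uniq_perm; rewrite ?filter_uniq// => i; rewrite !mem_filter.
by case: eqP => //= /eqP /s12.
Qed.

(** * The boundary of a boundary vanishes *)

Section CubicalBoundary.
Variable d : nat.
Implicit Types (Q P : cube d) (c z : chain d).

Lemma cube_dimE Q : cube_dim Q = #|[pred i | (Q i).2]|.
Proof. by apply: eq_card => j; exact: asboolb. Qed.

Lemma cube_rankE Q i : cube_rank Q i = #|[pred i' : 'I_d | (i' < i)%N && (Q i').2]|.
Proof. by apply: eq_card => j; exact: asboolb. Qed.

(** The boolean merges [face_plus] and [face_minus], so that all signs become powers of [-1] and an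
    iterated boundary is a sum over pairs of directions and booleans. *)
Definition face Q (i : 'I_d) (e : bool) : cube d :=
  cube_upd Q i ((Q i).1 + (e : int), false).

Lemma bd_coefE Q P : bd_coef Q P =
  \sum_(i | (Q i).2) \sum_e (-1) ^+ (cube_rank Q i) * (-1) ^+ (~~ e) *
    (P == face Q i e : int).
Proof.
apply: eq_bigr => i _; rewrite big_bool /= expr0 expr1 mulr1 mulrN1 mulNr -mulrBr.
by rewrite /face addr0.
Qed.

Lemma bd_coef_neq0 Q P : bd_coef Q P != 0 ->
  exists i e, (Q i).2 /\ P = face Q i e.
Proof.
rewrite bd_coefE => h; apply: contrapT => h'; move/negP: h; apply; apply/eqP.
apply: big1 => i Qi; apply: big1 => e _; case: eqP => [Pe|_]; last by rewrite mulr0.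
by case: h'; exists i, e.
Qed.

Lemma faceE Q i e j : face Q i e j = if j == i then ((Q i).1 + (e : int), false) else Q j.
Proof. by rewrite ffunE. Qed.

Lemma cube_dim_face Q i e : (Q i).2 -> cube_dim Q = (cube_dim (face Q i e)).+1.
Proof.
move=> Qi; rewrite !cube_dimE (cardD1 i) inE Qi; congr _.+1; apply: eq_card => j.
by rewrite !inE faceE; case: (eqVneq j i).
Qed.

Lemma cube_set_face (R : realType) Q i e : (Q i).2 ->
  cube_set R d (face Q i e) `<=` cube_set R d Q.
Proof.
move=> Qi x h j; have := h j; rewrite faceE; case: eqVneq => [->|//] /=.
by rewrite Qi intrD addr0; case: e {h} => /=; lra.
Qed.

Lemma mem_coface_cands Q P : bd_coef Q P != 0 -> Q \in coface_cands P.
Proof.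
move=> /bd_coef_neq0[i [e [Qi ->]]]; rewrite mem_undup; apply/flattenP.
exists [:: cube_upd (face Q i e) i ((face Q i e i).1 - 1, true);
           cube_upd (face Q i e) i ((face Q i e i).1, true)].
  by apply/mapP; exists i; rewrite ?mem_enum.
rewrite !inE faceE eqxx /=; case: e; apply/orP; [left|right]; apply/eqP/ffunP => j;
  rewrite !ffunE; case: eqVneq => [->|//]; rewrite ?addrK ?addr0 -Qi;
  by case: (Q i).
Qed.

Lemma bd_seqE (C : seq (cube d)) c P : uniq C -> (forall Q, c Q != 0 -> Q \in C) ->
  bd c P = \sum_(Q <- C) c Q * bd_coef Q P.
Proof.
move=> uC cC; apply: eq_big_uniq_support => //; first exact: undup_uniq.
by move=> Q; rewrite mulf_eq0 negb_or => /andP[/cC -> /mem_coface_cands ->].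
Qed.

Lemma faceC Q i j e e' : i != j ->
  face (face Q i e) j e' = face (face Q j e') i e.
Proof.
move=> ij; apply/ffunP => l; rewrite !faceE; have [->|lj] := eqVneq l j.
  by rewrite [j == i]eq_sym (negPf ij).
by rewrite (negPf ij).
Qed.

(** Collapsing direction [i] removes one nondegenerate factor before [j] exactly when [i < j]. *)
Lemma sign_cube_rank_face Q i j e : (Q i).2 -> i != j ->
  (-1) ^+ cube_rank (face Q i e) j = (-1) ^+ (i < j)%N * (-1) ^+ cube_rank Q j :> int.
Proof.
move=> Qi ij; rewrite -exprD !cube_rankE [in RHS](cardD1 i) inE Qi andbT addnA.
rewrite addnn exprD -[(-1) ^+ _.*2]signr_odd odd_double expr0 mul1r; congr (_ ^+ _).
apply: eq_card => l; rewrite !inE faceE; case: (eqVneq l i) => //= _.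
by rewrite andbF.
Qed.

Lemma bd_coef_face Q i e P : (Q i).2 -> bd_coef (face Q i e) P =
  \sum_(j | (i != j) && (Q j).2) \sum_e' (-1) ^+ (i < j)%N * (-1) ^+ (cube_rank Q j) *
    (-1) ^+ (~~ e') * (P == face (face Q i e) j e' : int).
Proof.
move=> Qi; rewrite bd_coefE; apply: eq_big => [j|j].
  by rewrite faceE eq_sym; case: eqVneq.
rewrite faceE; case: (eqVneq j i) => // ji Qj.
by apply: eq_bigr => e' _; rewrite sign_cube_rank_face// eq_sym.
Qed.

(** Collapsing [i] and [j] in either order gives the same cube, but exactly one of [i < j] and
    [j < i] holds, so the signs are opposite. Exchanging the directions thus shows [S = - S]. *)
Lemma bd_coef_bd_coef (C : seq (cube d)) Q P : uniq C ->
  (forall P', bd_coef Q P' != 0 -> P' \in C) ->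
  \sum_(P' <- C) bd_coef Q P' * bd_coef P' P = 0.
Proof.
move=> uC QC; pose F := undup [seq face Q ie.1 ie.2 | ie <- enum {: 'I_d * bool}].
have memF i e : face Q i e \in F.
  by rewrite mem_undup; apply/mapP; exists (i, e); rewrite ?mem_enum.
rewrite (eq_big_uniq_support (s2 := F)) ?undup_uniq//; last first.
  move=> P'; rewrite mulf_eq0 negb_or => /andP[h _]; rewrite QC//.
  by have [i [e [_ ->]]] := bd_coef_neq0 h; rewrite memF.
pose t (i j : 'I_d) (e e' : bool) : int := (-1) ^+ (i < j)%N * ((-1) ^+ cube_rank Q i *
  (-1) ^+ cube_rank Q j) * ((-1) ^+ (~~ e) * (-1) ^+ (~~ e')) *
  (P == face (face Q i e) j e' : int).
pose S := \sum_(i | (Q i).2) \sum_(j | (i != j) && (Q j).2) \sum_e \sum_e' t i j e e'.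
transitivity S.
  under eq_bigr do rewrite bd_coefE mulr_suml.
  rewrite exchange_big; apply: eq_bigr => i Qi /=.
  under eq_bigr do rewrite mulr_suml.
  rewrite exchange_big [RHS]exchange_big; apply: eq_bigr => e _ /=.
  rewrite (bigD1_seq (face Q i e)) ?undup_uniq//= eqxx mulr1 big1 ?addr0; last first.
    by move=> P' /negPf ->; rewrite mulr0 mul0r.
  rewrite bd_coef_face// mulr_sumr; apply: eq_bigr => j _; rewrite mulr_sumr.
  by apply: eq_bigr => e' _; rewrite /t; ring.
have : S = - S.
  rewrite {1}/S (exchange_big_dep (fun j => (Q j).2)) /=; last by move=> i j _ /andP[].
  rewrite -sumrN; apply: eq_bigr => j Qj; rewrite -sumrN.
  apply: eq_big => [i|i /and3P[Qi ij _]]; first by rewrite Qj andbT andbC eq_sym.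
  rewrite exchange_big -sumrN; apply: eq_bigr => e' _; rewrite -sumrN.
  apply: eq_bigr => e _; rewrite /t faceC//.
  rewrite [(-1) ^+ cube_rank Q i * _]mulrC [(-1) ^+ (~~ e) * _]mulrC -!mulNr.
  congr (_ * _ * _ * _); have := ij; rewrite neq_ltn => /orP[] h; rewrite h.
    by rewrite ltnNge (ltnW h) /= expr0 expr1.
  by rewrite ltnNge (ltnW h) /= expr0 expr1 opprK.
lia.
Qed.

End CubicalBoundary.

(** * The Betti number as a difference of rational ranks *)

Section BettiRank.
Variable d : nat.
Implicit Types (Q P : cube d) (c z : chain d) (C : seq (cube d)).

Definition supported c C := forall Q, c Q != 0 -> Q \in C.

(** Integral chains become rational row vectors, for which ranks are available. Conversely, by
    [coord_row_onto], every rational row is a chain up to a nonzero integer factor. *)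
Definition coord_row C c : 'rV[rat]_(size C) :=
  \row_j (c (tnth (in_tuple C) j))%:~R.

Definition bd_mx C C' : 'M[rat]_(size C, size C') :=
  \matrix_(i, j) (bd_coef (tnth (in_tuple C) i) (tnth (in_tuple C') j))%:~R.

Lemma coord_row_bd C C' c : uniq C -> supported c C ->
  coord_row C c *m bd_mx C C' = coord_row C' (bd c).
Proof.
move=> uC cC; apply/rowP => j; rewrite !mxE (bd_seqE _ uC cC) [X in _ = X%:~R]big_tnth rmorph_sum.
by apply: eq_bigr => i _; rewrite !mxE rmorphM.
Qed.

Lemma coord_row0 C c : supported c C -> coord_row C c = 0 -> forall Q, c Q = 0.
Proof.
move=> cC /rowP c0 Q; apply/eqP; apply: contraT => cQ.
have /tnthP[j Qj] : Q \in in_tuple C by exact: cC.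
by have := c0 j; rewrite !mxE -Qj => /eqP; rewrite intr_eq0 (negPf cQ).
Qed.

Lemma coord_row_onto C (u : 'rV[rat]_(size C)) : uniq C ->
  exists2 N : int, N != 0 & exists2 c, supported c C & coord_row C c = N%:~R *: u.
Proof.
move=> uC; have [N N0 [v vE]] := clear_denominators (u 0).
exists N => //; exists (fun Q => \sum_j v j * (Q == tnth (in_tuple C) j : int)).
  move=> Q; apply: contraNT => QC; apply/eqP/big1 => j _.
  case: eqP => [Qj|_]; last by rewrite mulr0.
  by move: QC; rewrite Qj (mem_tnth j (in_tuple C)).
apply/rowP => i; rewrite !mxE -vE; congr intr.
have inj : injective (tnth (in_tuple C)) by apply/tuple_uniqP.
rewrite (bigD1 i)//= eqxx mulr1 big1 ?addr0// => j ji.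
by rewrite (inj_eq inj) eq_sym (negPf ji) mulr0.
Qed.

Lemma coord_row_sum C m (a : 'I_m -> int) (z : 'I_m -> chain d) :
  coord_row C (fun P => \sum_i a i * z i P) =
  \sum_i (a i)%:~R *: coord_row C (z i).
Proof.
apply/rowP => j; rewrite mxE rmorph_sum summxE; apply: eq_bigr => i _.
by rewrite !mxE rmorphM.
Qed.

Lemma bd_mx_bd_mx C2 C1 C0 : uniq C1 ->
  (forall Q P, Q \in C2 -> bd_coef Q P != 0 -> P \in C1) ->
  bd_mx C2 C1 *m bd_mx C1 C0 = 0.
Proof.
move=> u1 cl; apply/matrixP => i j; rewrite !mxE.
rewrite (eq_bigr (fun l => ((bd_coef (tnth (in_tuple C2) i) (tnth (in_tuple C1) l) *
  bd_coef (tnth (in_tuple C1) l) (tnth (in_tuple C0) j))%:~R : rat))); last first.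
  by move=> l _; rewrite !mxE rmorphM.
rewrite -rmorph_sum -(big_tnth _ _ C1 xpredT
  (fun P => bd_coef (tnth (in_tuple C2) i) P * bd_coef P (tnth (in_tuple C0) j))).
by rewrite bd_coef_bd_coef// => P; apply: cl; exact: (mem_tnth i (in_tuple C2)).
Qed.

Context {R : realType}.
Implicit Types (X : set ('I_d -> R)) (k : nat).

Definition enumerates C X k :=
  uniq C /\ forall Q, Q \in C <-> cube_dim Q = k /\ cube_set R d Q `<=` X.

Lemma in_chainsP C X k c : enumerates C X k -> in_chains X k c <-> supported c C.
Proof.
move=> [_ CX]; split => [[_ h] Q /h /CX //|h]; split; first by exists C.
by move=> Q /h /CX.
Qed.

Lemma enumerates_faces C2 C1 X k : enumerates C1 X k -> enumerates C2 X k.+1 ->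
  forall Q P, Q \in C2 -> bd_coef Q P != 0 -> P \in C1.
Proof.
move=> [_ h1] [_ h2] Q P /h2[dQ QX] /bd_coef_neq0[i [e [Qi ->]]]; apply/h1; split.
  by move: dQ; rewrite (cube_dim_face e Qi) => -[].
by move=> x /(cube_set_face Qi)/QX.
Qed.

Lemma supported_bd C C' c : uniq C -> supported c C ->
  (forall Q P, Q \in C -> bd_coef Q P != 0 -> P \in C') -> supported (bd c) C'.
Proof.
move=> uC cC cl P; rewrite (bd_seqE _ uC cC); apply: contraNT => PC'.
apply/eqP; rewrite big_seq; apply: big1 => Q QC; apply/eqP; rewrite mulf_eq0.
by apply/orP; right; apply: contraNT PC' => /(cl _ _ QC).
Qed.

(** [C0] only has to contain the faces of [C1]; it need not enumerate cubes of dimension [k - 1], so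
    degree 0 is no exception. *)
Lemma cycleP C1 C0 X k z : enumerates C1 X k ->
  (forall Q P, Q \in C1 -> bd_coef Q P != 0 -> P \in C0) ->
  is_cycle X k z <-> supported z C1 /\ (coord_row C1 z <= kermx (bd_mx C1 C0))%MS.
Proof.
move=> C1X cl; rewrite /is_cycle (in_chainsP z C1X); have [u1 _] := C1X.
split=> -[zC h]; split=> //.
  apply/sub_kermxP; rewrite coord_row_bd//; apply/rowP => j; by rewrite !mxE h.
move: h => /sub_kermxP; rewrite coord_row_bd// => h.
exact: coord_row0 (supported_bd u1 zC cl) h.
Qed.

Lemma boundary_coord_row C2 C1 X k b : enumerates C2 X k.+1 ->
  is_boundary X k b -> (coord_row C1 b <= bd_mx C2 C1)%MS.
Proof.
move=> C2X [c [/(in_chainsP _ C2X) cC bE]]; have [u2 _] := C2X.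
rewrite (_ : coord_row C1 b = coord_row C2 c *m bd_mx C2 C1) ?submxMl//.
by rewrite coord_row_bd//; apply/rowP => j; rewrite !mxE bE.
Qed.

(** The factor [N] accounts for torsion: a cycle that bounds a rational chain may have only a
    multiple that bounds an integral one. *)
Lemma coord_row_boundary C2 C1 X k b : enumerates C1 X k -> enumerates C2 X k.+1 ->
  supported b C1 -> (coord_row C1 b <= bd_mx C2 C1)%MS ->
  exists2 N : int, N != 0 & is_boundary X k (fun P => N * b P).
Proof.
move=> C1X C2X bC /submxP[u bu]; have [u2 _] := C2X; have [u1 _] := C1X.
have [N N0 [c cC cE]] := coord_row_onto u u2.
exists N => //; exists c; split; first exact/(in_chainsP _ C2X).
have bdcC := supported_bd u2 cC (enumerates_faces C1X C2X).
suff h : forall P, N * b P - bd c P = 0 by move=> P; apply/eqP; rewrite -subr_eq0 h.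
apply: (@coord_row0 C1 (fun P => N * b P - bd c P)).
  move=> P; apply: contraNT => PC.
  have := bC P; have := bdcC P; rewrite (negPf PC) => h1 h2.
  case: eqP h1 => [->|_ /(_ isT)//] _; case: eqP h2 => [->|_ /(_ isT)//] _.
  by rewrite mulr0 subrr.
have : coord_row C1 (bd c) = N%:~R *: coord_row C1 b.
  by rewrite -(coord_row_bd C1 u2 cC) cE -scalemxAl -bu.
move=> /rowP h; apply/rowP => j; have := h j; rewrite !mxE rmorphB rmorphM /= => ->.
by rewrite subrr.
Qed.

(** The [m] cycles are the rows of [Z]. Independence modulo boundaries makes [Z] of full rank and
    its span disjoint from the boundaries, and both spaces consist of cycles. *)
Lemma hom_indep_le C2 C1 C0 X k m : enumerates C1 X k -> enumerates C2 X k.+1 ->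
  (forall Q P, Q \in C1 -> bd_coef Q P != 0 -> P \in C0) ->
  hom_indep X k m -> (m + \rank (bd_mx C2 C1) <= \rank (kermx (bd_mx C1 C0)))%N.
Proof.
move=> C1X C2X cl [z [zc zi]]; have [u1 _] := C1X.
set D := bd_mx C2 C1; set K := kermx _.
pose Z : 'M[rat]_(m, size C1) := \matrix_(i, j) coord_row C1 (z i) 0 j.
have rZ i : row i Z = coord_row C1 (z i) by apply/rowP => j; rewrite !mxE.
(* Denominators are cleared twice: [N] makes the coefficients integral, and [N'] turns the rational
   boundary into an integral one. Independence then kills [N' * b], hence [a]. *)
have key (a : 'rV[rat]_m) : (a *m Z <= D)%MS -> a = 0.
  move=> aZD; have [N N0 [b bE]] := clear_denominators (a 0).
  have zC : supported (fun P => \sum_i b i * z i P) C1.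
    move=> P; apply: contraNT => PC; apply/eqP; apply: big1 => i _.
    have [/(cycleP _ C1X cl)[sz _] _] := conj (zc i) I.
    have := sz P; rewrite (negPf PC); case: eqP => [->|_ /(_ isT)//] _.
    by rewrite mulr0.
  have bD : (coord_row C1 (fun P => \sum_i b i * z i P)%R <= D)%MS.
    rewrite coord_row_sum (_ : \sum_i _ = N%:~R *: (a *m Z)) ?scalemx_sub//.
    rewrite mulmx_sum_row scaler_sumr; apply: eq_bigr => i _.
    by rewrite bE rZ scalerA.
  have [N' N'0 bd] := coord_row_boundary C1X C2X zC bD.
  have {}bd : is_boundary X k (fun P => \sum_i (N' * b i) * z i P).
    move: bd; congr is_boundary; apply/funext => P; rewrite mulr_sumr.
    by apply: eq_bigr => i _; rewrite mulrA.
  apply/rowP => i; have /eqP := zi _ bd i; rewrite mulf_eq0 (negPf N'0) /= => /eqP bi.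
  have /eqP := bE i; rewrite bi eq_sym mulf_eq0 intr_eq0 (negPf N0) /= => /eqP ->.
  by rewrite mxE.
have rkZ : \rank Z = m.
  have : \rank (kermx Z) = 0%N.
    apply/eqP; rewrite mxrank_eq0; apply/eqP/row_matrixP => i; rewrite row0.
    by apply: key; rewrite -row_mul mulmx_ker row0 sub0mx.
  by rewrite mxrank_ker => /eqP; rewrite subn_eq0 => mZ; apply/eqP; rewrite eqn_leq rank_leq_row.
have ZD0 : (Z :&: D = 0)%MS.
  apply/eqP; rewrite -submx0; apply/rV_subP => u; rewrite sub_capmx.
  by move=> /andP[/submxP[a ->]] /key ->; rewrite mul0mx sub0mx.
rewrite -{1}rkZ -(mxrank_disjoint_sum ZD0) mxrankS// addsmx_sub; apply/andP; split.
  by apply/row_subP => i; rewrite rZ; have /(cycleP _ C1X cl)[] := zc i.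
by apply/sub_kermxP/bd_mx_bd_mx => //; exact: enumerates_faces C1X C2X.
Qed.

(** A basis of a complement of the boundaries inside the cycles, scaled to integral chains, is
    independent in homology. *)
Lemma hom_indep_rank C2 C1 C0 X k : enumerates C1 X k -> enumerates C2 X k.+1 ->
  (forall Q P, Q \in C1 -> bd_coef Q P != 0 -> P \in C0) ->
  hom_indep X k (\rank (kermx (bd_mx C1 C0)) - \rank (bd_mx C2 C1))%N.
Proof.
move=> C1X C2X cl; have [u1 _] := C1X.
set D := bd_mx C2 C1; set K := kermx _; pose S := (K :\: D)%MS.
have DK : (D <= K)%MS.
  by apply/sub_kermxP/bd_mx_bd_mx => //; exact: enumerates_faces C1X C2X.
have -> : (\rank K - \rank D)%N = \rank S.
  by rewrite -(mxrank_cap_compl K D) (capmx_idPr DK) addKn.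
have /fin_all_exists2[N N0] i := coord_row_onto (row i (row_base S)) u1.
move=> /fin_all_exists2[z zC zE]; exists z; split=> [i|a abd i].
  apply/(cycleP _ C1X cl); split => //; rewrite zE scalemx_sub//.
  apply: submx_trans (row_sub _ _) _; rewrite eq_row_base; exact: diffmxSl.
have := boundary_coord_row C1 C2X abd; rewrite coord_row_sum.
rewrite (_ : \sum_i _ = (\row_i ((a i)%:~R * (N i)%:~R)) *m row_base S); last first.
  by rewrite mulmx_sum_row; apply: eq_bigr => j _; rewrite zE scalerA mxE.
set v := \row_i _ => vD; have : (v *m row_base S <= S :&: D)%MS.
  rewrite sub_capmx vD andbT; apply: submx_trans (submxMl _ _) _.
  by rewrite eq_row_base.
rewrite capmx_diff submx0 => /eqP v0.
have : v = 0 by apply: (row_free_inj (row_base_free S)); rewrite mul0mx.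
move=> /rowP/(_ i); rewrite !mxE => /eqP; rewrite mulf_eq0 !intr_eq0 (negPf (N0 i)).
by rewrite orbF => /eqP.
Qed.

(** The two bounds show that the set in [betti] has a maximum, so [xget] does not fall back on its
    default value. The statement is additive because subtraction in [nat] truncates. *)
Lemma betti_rank C2 C1 C0 X k : enumerates C1 X k -> enumerates C2 X k.+1 ->
  (forall Q P, Q \in C1 -> bd_coef Q P != 0 -> P \in C0) ->
  (betti X k + \rank (bd_mx C2 C1) = \rank (kermx (bd_mx C1 C0)))%N.
Proof.
move=> C1X C2X cl; have [u1 _] := C1X.
have le_rk : (\rank (bd_mx C2 C1) <= \rank (kermx (bd_mx C1 C0)))%N.
  by apply/mxrankS/sub_kermxP/bd_mx_bd_mx => //; exact: enumerates_faces C1X C2X.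
rewrite /betti; case: xgetP => [b -> [hb hmax]|none].
  apply/eqP; rewrite eqn_leq (hom_indep_le C1X C2X cl hb) /=.
  by rewrite addnC -leq_subLR; apply: hmax; exact: hom_indep_rank.
have := none (\rank (kermx (bd_mx C1 C0)) - \rank (bd_mx C2 C1))%N.
case; split; first exact: hom_indep_rank.
by move=> m hm; rewrite leq_subRL// addnC; exact: (hom_indep_le C1X C2X cl).
Qed.

End BettiRank.

(** * A translation-invariant order, and cubes leading cycles *)

Section CubeOrder.
Variable d : nat.
Implicit Types (Q P : cube d) (x : 'I_d -> int).

Definition cube_key (s : seq 'I_d) Q : seqlexi_with Order.default_display int :=
  flatten [seq [:: (Q i).1; ((Q i).2 : int)] | i <- s].

Definition cube_le : rel (cube d) :=
  fun Q P => (cube_key (enum 'I_d) Q <= cube_key (enum 'I_d) P)%O.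

Lemma cube_key_inj : injective (cube_key (enum 'I_d)).
Proof.
move=> Q P QP; apply/ffunP => i.
have : i \in enum 'I_d by rewrite mem_enum.
move: QP; rewrite /cube_key; elim: (enum 'I_d) => //= j s IH [Q1 Q2 QP].
rewrite inE => /predU1P[->|]; last exact: IH.
move: Q1 Q2; case: (Q j) => a b; case: (P j) => a' b' /= -> Q2; congr pair.
by case: b b' Q2 => -[].
Qed.

Lemma cube_le_refl : reflexive cube_le.
Proof. by move=> Q; exact: lexx. Qed.

Lemma cube_le_total : total cube_le.
Proof. by move=> Q P; exact: le_total. Qed.

Lemma cube_le_trans : transitive cube_le.
Proof. by move=> Q P S; exact: le_trans. Qed.

Lemma cube_le_anti : antisymmetric cube_le.
Proof. by move=> Q P /le_anti/cube_key_inj. Qed.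

(** A translation adds the same integer to corresponding entries of both keys and fixes the
    degeneracy flags, so lexicographic comparison is unaffected. Leading cubes therefore move with
    the configuration. *)
Lemma cube_le_shift x Q P : cube_le (cube_shift x Q) (cube_shift x P) = cube_le Q P.
Proof.
rewrite /cube_le /cube_key; elim: (enum 'I_d) => //= i s IH.
by rewrite !lexi_cons IH !ffunE /= !lerD2r.
Qed.

End CubeOrder.

Section LeadingCubes.
Context (R : realType) (d : nat).
Implicit Types (Q P : cube d) (X : set ('I_d -> R)) (C : seq (cube d)).

Definition leading_cube X k Q := exists z : chain d,
  [/\ is_cycle X k z, z Q != 0 & forall P, z P != 0 -> cube_le P Q].

(** When [C1] is sorted, the largest cube of a chain is the last nonzero position of its coordinate
    row. Clearing denominators does not move that position, so integral and rational cycles have the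
    same leading cubes. *)
Lemma count_leading_cube C1 C0 X k : enumerates C1 X k -> sorted (@cube_le d) C1 ->
  (forall Q P, Q \in C1 -> bd_coef Q P != 0 -> P \in C0) ->
  count (fun Q => `[< leading_cube X k Q >]) C1 = \rank (kermx (bd_mx C1 C0)).
Proof.
move=> C1X srt cl; have [u1 _] := C1X.
rewrite mxrank_leads -sum1_count big_tnth -sum1_card.
have le_tnth (i j : 'I_(size C1)) : (i <= j)%N ->
    cube_le (tnth (in_tuple C1) i) (tnth (in_tuple C1) j).
  move=> ij; have x0 := tnth (in_tuple C1) i; rewrite !(tnth_nth x0) /=.
  apply: (sorted_leq_nth (@cube_le_trans d) (@cube_le_refl d) x0 srt) => //;
    by rewrite inE.
have inj : injective (tnth (in_tuple C1)) by apply/tuple_uniqP.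
apply: eq_bigl => i; rewrite inE; apply/asboolP/asboolP.
  move=> [z [/(cycleP _ C1X cl)[zC zK] zi zle]]; exists (coord_row C1 z) => //.
  apply/andP; split; first by rewrite mxE intr_eq0.
  apply/forallP => j; apply/implyP => ij; rewrite mxE intr_eq0.
  apply: contraTT ij => /zle ji; rewrite -leqNgt leqNgt; apply/negP => ij.
  have /inj e : tnth (in_tuple C1) i = tnth (in_tuple C1) j.
    by apply: cube_le_anti; rewrite ji le_tnth// ltnW.
  by move: ij; rewrite e ltnn.
move=> [u uK /andP[ui /forallP uj]]; have [N N0 [z zC zE]] := coord_row_onto u u1.
have zt j : (z (tnth (in_tuple C1) j))%:~R = N%:~R * u 0 j.
  by have /rowP/(_ j) := zE; rewrite !mxE.
exists z; split.
- by apply/(cycleP _ C1X cl); split => //; rewrite zE scalemx_sub.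
- by rewrite -(intr_eq0 rat) zt mulf_neq0 ?intr_eq0.
- move=> P zP; have /tnthP[j Pj] : P \in in_tuple C1 by exact: zC.
  rewrite Pj; apply: le_tnth; rewrite leqNgt; apply/negP => ij.
  move/negP: zP; apply; rewrite Pj -(intr_eq0 rat) zt.
  by have := uj j; rewrite ij => /eqP ->; rewrite mulr0.
Qed.

Lemma enumerates_sort C X k : enumerates C X k -> enumerates (sort (@cube_le d) C) X k.
Proof. by move=> [uC CX]; split; [rewrite sort_uniq|move=> Q; rewrite mem_sort]. Qed.

Theorem betti_leading_cubes C1 C2 X k : enumerates C1 X k -> enumerates C2 X k.+1 ->
  (betti X k + size C2 = count (fun Q => `[< leading_cube X k Q >]) C1 +
                         count (fun Q => `[< leading_cube X k.+1 Q >]) C2)%N.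
Proof.
move=> /enumerates_sort; set S1 := sort _ _ => S1X.
move=> /enumerates_sort; set S2 := sort _ _ => S2X.
have s1 : sorted (@cube_le d) S1 by exact: sort_sorted (@cube_le_total d) _.
have s2 : sorted (@cube_le d) S2 by exact: sort_sorted (@cube_le_total d) _.
(* Any list containing the faces will do as target; degenerate directions add entries that do no
   harm. *)
pose C0 := flatten [seq [seq face Q ie.1 ie.2 | ie <- enum {: 'I_d * bool}] | Q <- S1].
have cl Q P : Q \in S1 -> bd_coef Q P != 0 -> P \in C0.
  move=> QS /bd_coef_neq0[i [e [_ ->]]]; apply/flatten_mapP; exists Q => //.
  by apply/mapP; exists (i, e); rewrite ?mem_enum.
have p1 : perm_eq C1 S1 by rewrite perm_sym perm_sort.
have p2 : perm_eq C2 S2 by rewrite perm_sym perm_sort.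
rewrite (perm_size p2) (permP p1) (permP p2) (count_leading_cube S1X s1 cl).
rewrite (count_leading_cube S2X s2 (enumerates_faces S1X S2X)).
rewrite -(betti_rank S1X S2X cl) mxrank_ker -addnA subnKC//.
exact: rank_leq_row.
Qed.

End LeadingCubes.

(** * Cubes in windows, and the two bounds on the counts *)

Section CubeGeometry.
Context (R : realType) (d : nat).
Implicit Types (Q P : cube d) (X : set ('I_d -> R)) (w : Omega R d).
Implicit Types (v : {ffun 'I_d -> int}) (t : R) (z : chain d).

(* Any cube through the barycenter of [Q] contains [Q]. *)
Lemma cube_set_sub_Xt w t Q : cube_set R d Q `<=` Xt w t <->
  exists P, w P <= t /\ cube_set R d Q `<=` cube_set R d P.
Proof.
split=> [QX|[P [wP QP]] x /QP Px]; last by exists P.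
pose x (i : 'I_d) : R := ((Q i).1)%:~R + ((Q i).2)%:R / 2.
have [|P [wP Px]] := QX x.
  by move=> i; rewrite /x; case: (Q i).2 => /=; lra.
exists P; split => // y Qy i; have := Qy i; have := Px i; rewrite /x.
case: (Q i) => a b; case: (P i) => a' b' /=.
(* Integers stay ordered under a slack below one; the barycenter brings in a slack of [1 / 2]. *)
have le_int (m n : int) (r : R) : r < 1 -> m%:~R <= n%:~R + r -> m%:~R <= n%:~R :> R.
  move=> r1 mnr; rewrite ler_int; apply/negPn/negP; rewrite -ltNge => nm.
  have : (n + 1)%:~R <= m%:~R :> R by rewrite ler_int; lia.
  by rewrite intrD; lra.
case: b => /=; last by lra.
move=> /andP[h1 h2] /andP[h3 h4]; have h5 := le_int _ _ (1 / 2) ltac:(lra) h1.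
have h6 : (a + 1)%:~R <= (a' + b')%:~R + 1 / 2 :> R.
  by rewrite !intrD; case: b' h2 => /=; lra.
move: (le_int _ _ (1 / 2) ltac:(lra) h6) h2; rewrite !intrD; clear h6.
by case: b' => /=; lra.
Qed.

Definition in_box (n : nat) Q := forall i, - n%:Z <= (Q i).1 < n%:Z.

Lemma in_box_sub_Lambda n Q : in_box n Q -> cube_set R d Q `<=` Lambda R d n.
Proof.
move=> Qn x Qx i; have := Qx i; have /andP[h1 h2] := Qn i.
have : (- n%:Z)%:~R <= ((Q i).1)%:~R :> R by rewrite ler_int.
have : ((Q i).1 + 1)%:~R <= n%:Z%:~R :> R by rewrite ler_int; lia.
by rewrite intrD rmorphN /=; case: (Q i).2 => /=; lra.
Qed.

(** A degenerate factor [[n]] fits in the window although its corner [n] lies outside the half-open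
    box of size [n]; hence [n.+1]. *)
Lemma sub_Lambda_in_box n Q : cube_set R d Q `<=` Lambda R d n -> in_box n.+1 Q.
Proof.
move=> QL i; have [|h1 h2] := andP (QL (fun j => ((Q j).1)%:~R) _ i).
  by move=> j; rewrite lexx lerDl ler0n.
move: h1 h2; rewrite -[n%:R]/(n%:Z%:~R) -rmorphN !ler_int; lia.
Qed.

Lemma sub_Xn w t n Q : cube_set R d Q `<=` Xn w t n <->
  cube_set R d Q `<=` Xt w t /\ cube_set R d Q `<=` Lambda R d n.
Proof.
split=> [h|[h1 h2] x Qx]; last by split; [exact: h1|exact: h2].
by split => x /h[].
Qed.

(** A cube is a corner together with one of finitely many shapes. A count of cubes is thus a sum
    over corners, the form required by the ergodic theorem. *)
Definition cube_of v (S : {ffun 'I_d -> bool}) : cube d := [ffun i => (v i, S i)].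

Definition shapes (k : nat) : seq {ffun 'I_d -> bool} :=
  [seq S <- enum {ffun 'I_d -> bool} | cube_dim (cube_of 0 S) == k].

Definition cubes (k n : nat) : seq (cube d) :=
  [seq cube_of v s | v <- box n (enum 'I_d), s <- shapes k].

Lemma cube_dim_of v S : cube_dim (cube_of v S) = cube_dim (cube_of 0 S).
Proof. by rewrite !cube_dimE; apply: eq_card => i; rewrite !inE !ffunE. Qed.

Lemma cube_of_shift v S : cube_of v S = cube_shift v (cube_of 0 S).
Proof. by apply/ffunP => i; rewrite !ffunE add0r. Qed.

Lemma mem_cubes k n Q : Q \in cubes k n <-> cube_dim Q = k /\ in_box n Q.
Proof.
split=> [/allpairsP[[v s] /= [+ + ->]]|[Qk Qn]].
  rewrite mem_filter mem_box ?enum_uniq// => /forallP vn /andP[/eqP dS _].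
  split; first by rewrite cube_dim_of.
  by move=> i; have := vn i; rewrite mem_enum /= ffunE.
have QE : Q = cube_of [ffun i => (Q i).1] [ffun i => (Q i).2].
  by apply/ffunP => i; rewrite !ffunE; case: (Q i).
apply/allpairsP; exists ([ffun i => (Q i).1], [ffun i => (Q i).2]); split => //=.
  rewrite mem_box ?enum_uniq//; apply/forallP => i.
  by rewrite mem_enum /= ffunE; exact: Qn.
by rewrite mem_filter mem_enum andbT -(cube_dim_of [ffun i => (Q i).1]) -QE Qk.
Qed.

Lemma cubes_uniq k n : uniq (cubes k n).
Proof.
apply: allpairs_uniq; first exact: box_uniq (enum_uniq _).
  by rewrite filter_uniq// enum_uniq.
move=> [v s] [v' s'] _ _ /= /ffunP h; congr pair; apply/ffunP => i;
  by have := h i; rewrite !ffunE => -[].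
Qed.

Lemma enumerates_Xn w t n k : enumerates
  [seq Q <- cubes k n.+1 | `[< cube_set R d Q `<=` Xn w t n >]] (Xn w t n) k.
Proof.
split; first by rewrite filter_uniq// cubes_uniq.
move=> Q; rewrite mem_filter; split => [/andP[/asboolP QX /mem_cubes[] //]|[Qk QX]].
rewrite (asboolT QX); apply/mem_cubes; split => //.
by apply: sub_Lambda_in_box; have /sub_Xn[] := QX.
Qed.

Lemma is_cycle_sub X X' k z : X `<=` X' -> is_cycle X k z -> is_cycle X' k z.
Proof.
move=> XX' [[fs zX] bz]; split => //; split => // Q /zX[dQ QX]; split => //.
by move=> x /QX/XX'.
Qed.

(** Only the extent of the cycle around [Q] is limited. It is taken in all of [X(t)] and not in a
    window, which keeps the property compatible with translations. *)
Definition local_lead w t k (K : nat) Q := exists z : chain d,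
  [/\ is_cycle (Xt w t) k z, z Q != 0 &
   forall P, z P != 0 -> cube_le P Q /\ forall i, `|(P i).1 - (Q i).1| <= K%:Z].

Lemma local_lead_mono w t k K K' Q : (K <= K')%N ->
  local_lead w t k K Q -> local_lead w t k K' Q.
Proof.
move=> KK' [z [zc zQ zl]]; exists z; split => // P /zl[PQ h]; split => // i.
by apply: le_trans (h i) _; rewrite lez_nat.
Qed.

Lemma leading_local_lead w t k Q : leading_cube (Xt w t) k Q ->
  exists K, local_lead w t k K Q.
Proof.
move=> [z [[[[s zs] zX] bz] zQ zl]].
(* The sum of all coordinate distances over the support, a cheap bound for their maximum. *)
exists (\sum_(P <- s) \sum_i `|(P i).1 - (Q i).1|%N)%N.
exists z; split=> [||P zP]; [by split => //; split => //; exists s|by []|].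
split=> [|i]; first exact: zl.
rewrite -abszE lez_nat (perm_big _ (perm_to_rem (zs _ zP))) big_cons (bigD1 i)//=.
by rewrite -addnA leq_addr.
Qed.

Lemma local_lead_leading w t k K Q : local_lead w t k K Q -> leading_cube (Xt w t) k Q.
Proof. by move=> [z [zc zQ zl]]; exists z; split => // P /zl[]. Qed.

Lemma count_uniq_le (T : eqType) (p q : pred T) (s s' : seq T) : uniq s ->
  (forall x, x \in s -> p x -> (x \in s') && q x) -> (count p s <= count q s')%N.
Proof.
move=> us h; rewrite -!size_filter; apply: uniq_leq_size; first exact: filter_uniq.
by move=> x; rewrite !mem_filter => /andP[px xs]; rewrite andbC h.
Qed.

Definition num_leading w t k n := count (fun Q => `[< leading_cube (Xn w t n) k Q >])
  [seq Q <- cubes k n.+1 | `[< cube_set R d Q `<=` Xn w t n >]].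

Definition num_cubes w t k n :=
  count (fun Q => `[< cube_set R d Q `<=` Xn w t n >]) (cubes k n.+1).

Lemma betti_num w t k n : (betti (Xn w t n) k + num_cubes w t k.+1 n =
  num_leading w t k n + num_leading w t k.+1 n)%N.
Proof.
rewrite -(betti_leading_cubes (enumerates_Xn w t n k) (enumerates_Xn w t n k.+1)).
by rewrite size_filter.
Qed.

(** A cycle within distance [K] of a cube of the box stays in the box enlarged by [K], so it is a
    cycle of the larger window. *)
Lemma num_leading_ge w t k n K :
  (count (fun Q => `[< local_lead w t k K Q >]) (cubes k n) <= num_leading w t k (n + K))%N.
Proof.
apply: count_uniq_le; first exact: cubes_uniq.
move=> Q /mem_cubes[dQ Qn] /asboolP[z [[[fs zX] bz] zQ zl]].
have zXn P : z P != 0 -> cube_set R d P `<=` Xn w t (n + K).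
  move=> zP; apply/sub_Xn; split; first by have [] := zX P zP.
  apply: in_box_sub_Lambda => i; have [_ /(_ i)] := zl P zP; have := Qn i.
  by rewrite PoszD; lia.
have lead : leading_cube (Xn w t (n + K)) k Q.
  exists z; split => //; last by move=> P /zl[].
  by split => //; split => // P zP; split; [have [] := zX P zP|exact: zXn].
rewrite (asboolT lead) andbT; apply/(proj2 (enumerates_Xn w t (n + K) k) Q).
by split => //; exact: zXn.
Qed.

Lemma num_leading_le w t k n : (num_leading w t k n <=
  count (fun Q => `[< leading_cube (Xt w t) k Q >]) (cubes k n.+1))%N.
Proof.
apply: count_uniq_le; first by rewrite filter_uniq// cubes_uniq.
move=> Q; rewrite mem_filter => /andP[_ ->] /asboolP[z [zc zQ zl]].
apply/asboolP; exists z; split => //; apply: is_cycle_sub zc.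
by move=> x [].
Qed.

Lemma num_cubes_ge w t k n K : (count (fun Q => `[< cube_set R d Q `<=` Xt w t >])
  (cubes k n) <= num_cubes w t k (n + K))%N.
Proof.
apply: count_uniq_le; first exact: cubes_uniq.
move=> Q /mem_cubes[dQ Qn] /asboolP QX.
have QL : in_box (n + K) Q by move=> i; have := Qn i; rewrite PoszD; lia.
have -> : Q \in cubes k (n + K).+1.
  by apply/mem_cubes; split => // i; have := QL i; lia.
by apply/asboolP/sub_Xn; split => //; exact: in_box_sub_Lambda.
Qed.

Lemma num_cubes_le w t k n : (num_cubes w t k n <=
  count (fun Q => `[< cube_set R d Q `<=` Xt w t >]) (cubes k n.+1))%N.
Proof.
by apply: sub_count => Q /asboolP /sub_Xn[QX _]; exact/asboolP.
Qed.

End CubeGeometry.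

(** * Translation covariance and measurability of the events *)

Section Translation.
Context (R : realType) (d : nat).
Implicit Types (Q P : cube d) (w : Omega R d) (u v : {ffun 'I_d -> int}).
Implicit Types (t : R) (z : chain d).

(** The sign is opposite to that of [tau]: a property of [cube_shift v Q] in [w] becomes the same
    property of [Q] in [translate v w]. *)
Definition translate v w : Omega R d := fun Q => w (cube_shift v Q).

Lemma cube_shiftD u v Q : cube_shift u (cube_shift v Q) = cube_shift (v + u)%R Q.
Proof. by apply/ffunP => i; rewrite !ffunE /= addrA. Qed.

Lemma cube_shift0 Q : cube_shift (0 : {ffun 'I_d -> int}) Q = Q.
Proof. by apply/ffunP => i; rewrite !ffunE addr0; case: (Q i). Qed.

Lemma cube_shiftK v : cancel (cube_shift v) (cube_shift (- v : {ffun 'I_d -> int})).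
Proof. by move=> Q; rewrite cube_shiftD subrr cube_shift0. Qed.

Lemma cube_shift_inj v : injective (cube_shift v).
Proof. exact: can_inj (cube_shiftK v). Qed.

Lemma translate0 w : translate 0 w = w.
Proof. by apply/funext => Q; rewrite /translate cube_shift0. Qed.

Lemma translateD u v w : translate (u + v) w = translate u (translate v w).
Proof. by apply/funext => Q; rewrite /translate cube_shiftD. Qed.

Lemma translateE v w : translate v w = tau (fun i => - v i) w.
Proof.
apply/funext => Q; rewrite /translate /tau; congr w.
by apply/ffunP => i; rewrite !ffunE opprK.
Qed.

Lemma cube_set_shift v Q (x : 'I_d -> R) :
  cube_set R d (cube_shift v Q) x <-> cube_set R d Q (fun i => x i - (v i)%:~R).
Proof.
by split => h i; move: (h i); rewrite ffunE /= intrD; lra.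
Qed.

Lemma Xt_translate v w t (x : 'I_d -> R) :
  Xt w t x -> Xt (translate v w) t (fun i => x i - (v i)%:~R).
Proof.
move=> [Q [wQ Qx]]; exists (cube_shift (- v) Q); split.
  by rewrite /translate cube_shiftD addNr cube_shift0.
apply/cube_set_shift => i; have := Qx i; rewrite ffunE rmorphN /=; lra.
Qed.

Lemma cube_sub_Xt_translate v w t Q : cube_set R d (cube_shift v Q) `<=` Xt w t ->
  cube_set R d Q `<=` Xt (translate v w) t.
Proof.
move=> h x Qx; pose y i := x i + (v i)%:~R.
have xy : x = (fun i => y i - (v i)%:~R) by apply/funext => i; rewrite /y addrK.
by rewrite xy; apply/Xt_translate/h/cube_set_shift; rewrite -xy.
Qed.

Lemma cube_sub_Xt_shift v w t Q : cube_set R d (cube_shift v Q) `<=` Xt w t <->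
  cube_set R d Q `<=` Xt (translate v w) t.
Proof.
split; first exact: cube_sub_Xt_translate.
rewrite -{1}(cube_shiftK v Q) => /cube_sub_Xt_translate.
by rewrite -translateD addNr translate0.
Qed.

Lemma cube_dim_shift (x : 'I_d -> int) Q : cube_dim (cube_shift x Q) = cube_dim Q.
Proof. by rewrite !cube_dimE; apply: eq_card => i; rewrite !inE ffunE. Qed.

Lemma bd_coef_shift (x : 'I_d -> int) Q P : injective (cube_shift x) ->
  bd_coef (cube_shift x Q) (cube_shift x P) = bd_coef Q P.
Proof.
move=> inj; rewrite !bd_coefE; apply: eq_big => [i|i _]; first by rewrite ffunE.
apply: eq_bigr => e _; congr (_ ^+ _ * _ * _).
  by rewrite !cube_rankE; apply: eq_card => j; rewrite !inE ffunE.
congr (Posz (nat_of_bool _)); rewrite -[RHS](inj_eq inj); congr (_ == _).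
apply/ffunP => j; rewrite /face !ffunE.
by case: (eqVneq j i) => [->|] //=; rewrite addrAC.
Qed.

Lemma bd_shift v z P : bd (z \o cube_shift v) P = bd z (cube_shift v P).
Proof.
have inj := @cube_shift_inj v; transitivity (\sum_(Q <- [seq cube_shift v Q | Q <- coface_cands P])
    z Q * bd_coef Q (cube_shift v P)).
  by rewrite big_map; apply: eq_bigr => Q _; rewrite bd_coef_shift.
apply: eq_big_uniq_support; rewrite ?map_inj_uniq ?undup_uniq// => Q.
rewrite mulf_eq0 negb_or => /andP[_ h]; rewrite (mem_coface_cands h).
move: h; rewrite -(cube_shiftK (- v) Q) opprK bd_coef_shift// => /mem_coface_cands h.
by apply/mapP; exists (cube_shift (- v) Q).
Qed.

Lemma is_cycle_shift v w t k z : is_cycle (Xt w t) k z ->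
  is_cycle (Xt (translate v w) t) k (z \o cube_shift v).
Proof.
move=> [[[s zs] zX] bz]; split; last by move=> P; rewrite bd_shift.
split=> [|Q /= /zX[dQ QX]].
  exists [seq cube_shift (- v) Q | Q <- s] => Q /= zQ; apply/mapP.
  by exists (cube_shift v Q); [exact: zs|rewrite cube_shiftK].
split; first by rewrite -dQ cube_dim_shift.
exact/cube_sub_Xt_shift.
Qed.

Lemma local_lead_translate v w t k K Q : local_lead w t k K (cube_shift v Q) ->
  local_lead (translate v w) t k K Q.
Proof.
move=> [z [zc zQ zl]]; exists (z \o cube_shift v); split => //.
  exact: is_cycle_shift.
move=> P /= /zl[PQ h]; split; first by rewrite -(cube_le_shift v).
by move=> i; have := h i; rewrite !ffunE /= opprD addrACA subrr addr0.
Qed.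

Lemma local_lead_shift v w t k K Q : local_lead w t k K (cube_shift v Q) <->
  local_lead (translate v w) t k K Q.
Proof.
split; first exact: local_lead_translate.
rewrite -{1}(cube_shiftK v Q) => /local_lead_translate.
by rewrite -translateD addNr translate0.
Qed.

Lemma leading_cube_shift v w t k Q : leading_cube (Xt w t) k (cube_shift v Q) <->
  leading_cube (Xt (translate v w) t) k Q.
Proof.
split=> /leading_local_lead[K h]; apply: (@local_lead_leading _ _ _ _ _ K);
  exact/local_lead_shift.
Qed.

Lemma measurable_value Q (B : set R) : measurable B ->
  measurable [set w : Omega R d | B (w Q)].
Proof. by move=> mB; apply: sub_sigma_algebra; exists Q, B. Qed.

Lemma measurable_translate v : measurable_fun setT (translate v).
Proof.
apply: (@measurability _ _ _ _ setT (translate v) (cylinders R d)) => // _ [_ [Q [B [mB ->]]] <-].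
rewrite setTI; exact: (measurable_value (cube_shift v Q) mB).
Qed.

Lemma countable_bigcup_measurable (I : countType) (D : set I)
    (F : I -> set (Omega R d)) :
  (forall i, D i -> measurable (F i)) -> measurable (\bigcup_(i in D) F i).
Proof.
move=> mF; rewrite (_ : \bigcup_(i in D) F i =
    \bigcup_n (if unpickle n is Some i then if `[< D i >] then F i else set0 else set0)).
  apply: bigcupT_measurable => n; case: unpickle => [i|//].
  by case: asboolP => // /mF.
apply/seteqP; split => w [].
  by move=> i Di Fi; exists (pickle i) => //; rewrite pickleK asboolT.
move=> n _; case: unpickle => [i|//]; case: asboolP => // Di Fi; by exists i.
Qed.

(** A cube covered by the union [X(t)] already lies in one of its cubes, which turns the event into
    a countable union of coordinate events. *)
Lemma measurable_cube_sub_Xt t Q :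
  measurable [set w : Omega R d | cube_set R d Q `<=` Xt w t].
Proof.
rewrite (_ : [set w | _] = \bigcup_(P in [set P | cube_set R d Q `<=` cube_set R d P])
    [set w : Omega R d | (w P <= t)%R]).
  apply: (@countable_bigcup_measurable {ffun 'I_d -> (int * bool)%type}) => P _.
  have := @measurable_value P [set` `]-oo, t]] (measurable_itv _).
  by congr measurable; apply/seteqP; split => w /=; rewrite in_itv.
apply/seteqP; split => w /= => [/cube_set_sub_Xt[P [wP QP]]|[P QP wP]].
  by exists P.
by apply/cube_set_sub_Xt; exists P.
Qed.

(** Finite lists of cubes with coefficients form a countable type, unlike arbitrary functions; every
    finitely supported chain arises from such a list. *)
Definition chain_of (s : seq (cube d * int)) : chain d :=
  fun P => \sum_(e <- s) e.2 * (P == e.1 : int).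

Lemma chain_of_supported z (s : seq (cube d)) : (forall Q, z Q != 0 -> Q \in s) ->
  z = chain_of [seq (Q, z Q) | Q <- undup s].
Proof.
move=> zs; apply/funext => P; rewrite /chain_of big_map /=.
have [zP|/zs Ps] := eqVneq (z P) 0.
  rewrite zP big1// => Q _; case: eqP => [<-|_]; by rewrite ?zP ?mul0r ?mulr0.
rewrite (bigD1_seq P) ?mem_undup ?undup_uniq//= eqxx mulr1 big1 ?addr0// => Q QP.
by rewrite eq_sym (negPf QP) mulr0.
Qed.

(** Whether a chain is a suitable cycle does not depend on [w]; only the containment of its cubes in
    [X(t)] does. The event is a countable union, over suitable lists, of intersections of
    containment events. *)
Lemma measurable_local_lead t k K Q :
  measurable [set w : Omega R d | local_lead w t k K Q].
Proof.
pose I := seq ({ffun 'I_d -> (int * bool)%type} * int).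
pose ok (s : I) := [/\ forall P, chain_of s P != 0 -> cube_dim P = k,
  forall P, bd (chain_of s) P = 0, chain_of s Q != 0 &
  forall P, chain_of s P != 0 -> cube_le P Q /\ forall i, `|(P i).1 - (Q i).1| <= K%:Z].
rewrite (_ : [set w | _] = \bigcup_(s in ok) \bigcap_(P in [set P | chain_of s P != 0])
    [set w : Omega R d | cube_set R d P `<=` Xt w t]).
  apply: (@countable_bigcup_measurable I) => s _.
  rewrite -[X in measurable X]setCK setC_bigcap; apply: measurableC.
  apply: (@countable_bigcup_measurable {ffun 'I_d -> (int * bool)%type}) => P _.
  by apply: measurableC; exact: measurable_cube_sub_Xt.
apply/seteqP; split => w /=.
  move=> [z [[[[s zs] zX] bz] zQ zl]].
  exists [seq (P, z P) | P <- undup s].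
    by rewrite /ok /= -(chain_of_supported zs); split => // P /zX[].
  by move=> P; rewrite /= -(chain_of_supported zs) => /zX[].
move=> [s [sk sb sQ sl] sX]; exists (chain_of s); split => //.
split => //; split; last by move=> P sP; split; [exact: sk|exact: sX].
exists [seq e.1 | e <- s] => P; apply: contraNT => Ps; apply/eqP.
apply: big1_seq => e /= es; case: eqP => [Pe|_]; last by rewrite mulr0.
by move: Ps; rewrite Pe map_f.
Qed.

Lemma measurable_leading_cube t k Q :
  measurable [set w : Omega R d | leading_cube (Xt w t) k Q].
Proof.
rewrite (_ : [set w | _] = \bigcup_K [set w : Omega R d | local_lead w t k K Q]).
  by apply: bigcupT_measurable => K; exact: measurable_local_lead.
apply/seteqP; split => w /=; first by move=> /leading_local_lead[K h]; exists K.
by move=> [K _]; exact: local_lead_leading.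
Qed.

(** The local function to be averaged: it looks only at cubes with corner at the origin, so its
    translates count each cube once, at its corner. *)
Definition type_count (E : cube d -> set (Omega R d)) k w : R :=
  \sum_(s <- shapes d k) \1_(E (cube_of 0 s)) w.

Lemma bmeas_type_count E k : (forall Q, measurable (E Q)) -> bmeas (type_count E k).
Proof. by move=> mE; apply: bmeas_sum => s; exact: bmeas_indic. Qed.

Lemma norm_type_count E k w : `|type_count E k w| <= (size (shapes d k))%:R.
Proof.
apply: le_trans (ler_norm_sum _ _ _) _; rewrite -sumr_const_seq.
by apply: ler_sum => s _; rewrite indicE; case: (_ \in _); rewrite ?normr1 ?normr0.
Qed.

Lemma count_cubes (E : cube d -> set (Omega R d)) k n w :
  (forall v Q w, E (cube_shift v Q) w <-> E Q (translate v w)) ->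
  (count (fun Q => `[< E Q w >]) (cubes d k n))%:R =
  \sum_(v <- box n (enum 'I_d)) type_count E k (translate v w).
Proof.
move=> tr; rewrite -sum1_count big_mkcond natr_sum big_allpairs_dep /=.
apply: eq_bigr => v _; apply: eq_bigr => s _; rewrite indicE cube_of_shift.
congr ((nat_of_bool _)%:R); apply/asboolP/idP => [/tr h|/set_mem h]; last exact/tr.
exact: mem_set.
Qed.

End Translation.

(** * Almost sure densities and the limit *)

Section Densities.
Context (R : realType) (d : nat) (P : probability (Omega R d) R).
Hypotheses (Pstat : stationary P) (Perg : ergodic P).
Implicit Types (f : Omega R d -> R) (w : Omega R d).

Local Notation box_sum f n w :=
  (\sum_(v <- box n (enum 'I_d)) f (@translate R d v w)).

Lemma box_sum_cvg f : bmeas f ->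
  {ae P, forall w, (fun n => box_sum f n w / (2 * n)%:R ^+ d) @ \oo --> \int[P]_x f x}.
Proof.
move=> bf; have tauE v : @translate R d v = tau (fun i => - v i).
  by apply/funext => w; rewrite translateE.
have := @box_mean_ergodic _ _ R P d (@translate R d) (@translate0 R d)
  (@translateD R d) (@measurable_translate R d).
rewrite /box_mean size_enum_ord; apply => //.
  by move=> v A mA; rewrite tauE; exact: Pstat.
move=> A mA inv; apply: Perg => // x.
rewrite (_ : tau x = @translate R d [ffun i => - x i]) ?inv//.
by apply/funext => w; rewrite translateE; congr (tau _ w); apply/funext => i; rewrite ffunE opprK.
Qed.

(** Enlarging the box by a fixed margin does not change its volume asymptotically, so both bounds
    may be normalised by the volume of the window. *)
Lemma cvg_ratio (K : nat) :
  (fun n : nat => ((2 * (n + K))%:R / (2 * n)%:R) ^+ d : R) @ \oo --> (1 : R).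
Proof.
rewrite -[X in _ --> X](expr1n R d); apply: (@continuous_cvg _ _ _ _ _ _ (fun x : R => x ^+ d)).
  exact: exprn_continuous.
have : (fun n : nat => 1 + K%:R / n%:R : R) @ \oo --> (1 + 0 : R).
  apply: cvgD; first exact: cvg_cst.
  by apply: (cvg_bounded_div (u := fun=> K%:R) (C := K%:R)) => n; rewrite ger0_norm.
rewrite addr0; apply: cvg_trans; apply: near_eq_cvg; exists 1%N => // n /= n1.
have n0 : n%:R != 0 :> R by rewrite pnatr_eq0 -lt0n.
by rewrite !natrM natrD; field.
Qed.

(** For each [K] the lower bound has density the integral of [F K], and the upper bound has density
    the integral of [f]; bounded convergence closes the gap as [K] grows. *)
Lemma density_cvg (u : nat -> Omega R d -> R) (F : nat -> Omega R d -> R) f M :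
  (forall K, bmeas (F K)) -> bmeas f -> (forall K w, `|F K w| <= M) ->
  (forall w, F ^~ w @ \oo --> f w) ->
  (forall K n w, box_sum (F K) n w <= u (n + K)%N w) ->
  (forall n w, u n w <= box_sum f n.+1 w) ->
  {ae P, forall w, (fun n => u n w / (2 * n)%:R ^+ d) @ \oo --> \int[P]_x f x}.
Proof.
move=> bF bf FM Ff lb ub; set c := \int[P]_x f x.
have cF : (fun K => \int[P]_x F K x) @ \oo --> c.
  apply: (bounded_cvg_int (M := M)) => //; first by move=> K; case: (bF K).
  exact: aeW.
(* There are countably many [K], so a single null set serves them all. *)
have /ae_foralln aeF : forall K, {ae P, forall w,
    (fun n => box_sum (F K) n w / (2 * n)%:R ^+ d) @ \oo --> \int[P]_x F K x}.
  by move=> K; exact: box_sum_cvg.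
apply: filterS2 aeF (box_sum_cvg bf) => w cFw cfw.
have pos n : (0 < n)%N -> 0 < (2 * n)%:R ^+ d :> R.
  by move=> n0; rewrite exprn_gt0// ltr0n muln_gt0.
apply/cvgrPdist_lt => e e0.
have [K0 _ /(_ K0 (leqnn _)) hK] := (cvgr_gt c cF) (c - e / 2) ltac:(lra).
(* The division by the ratio replaces the volume of the box of size [n] by that of the window of
   size [n + K0], to which the lower bound refers. *)
have lowc : (fun n => box_sum (F K0) n w / (2 * n)%:R ^+ d /
    ((2 * (n + K0))%:R / (2 * n)%:R) ^+ d) @ \oo --> \int[P]_x F K0 x.
  rewrite -[X in _ --> X]divr1; apply: cvgM; first exact: cFw.
  by apply: cvgV; [exact: oner_neq0|exact: cvg_ratio].
have upc : (fun n => box_sum f n.+1 w / (2 * n.+1)%:R ^+ d *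
    ((2 * (n + 1))%:R / (2 * n)%:R) ^+ d) @ \oo --> c.
  rewrite -[X in _ --> X]mulr1; apply: cvgM; last exact: cvg_ratio.
  by have := cfw; rewrite -(cvg_shiftS (fun n => box_sum f n w / (2 * n)%:R ^+ d)).
have [N1 _ hN1] := (cvgr_gt _ lowc) (c - e) ltac:(lra).
have [N2 _ hN2] := (cvgr_lt _ upc) (c + e) ltac:(lra).
(* This makes [m - K0] at least [N1], and both [m] and [m - K0] positive, so that the volumes may be
   cancelled. *)
exists (maxn (N1 + K0).+1 N2.+1 + K0)%N => // m /= hm.
have m0 : (0 < m)%N by lia.
have lo : c - e < u m w / (2 * m)%:R ^+ d.
  have mK : m = (m - K0 + K0)%N by lia.
  have N1m : (N1 <= m - K0)%N by lia.
  have /lt_le_trans := hN1 _ N1m; apply.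
  rewrite -mK expr_div_n invf_div mulrA divfK; last by rewrite gt_eqF// pos//; lia.
  by rewrite ler_pM2r ?invr_gt0 ?pos// {2}mK.
have up : u m w / (2 * m)%:R ^+ d < c + e.
  have N2m : (N2 <= m)%N by lia.
  have := hN2 _ N2m; apply: le_lt_trans.
  rewrite addn1 expr_div_n mulrA divfK; last by rewrite gt_eqF// pos.
  by rewrite ler_pM2r ?invr_gt0 ?pos.
by rewrite ltr_norml; lra.
Qed.

Lemma num_cubes_cvg (t : R) k : exists c : R, {ae P, forall w,
  (fun n => (num_cubes w t k n)%:R / (2 * n)%:R ^+ d) @ \oo --> c}.
Proof.
pose E Q := [set w : Omega R d | cube_set R d Q `<=` Xt w t].
have mE Q : measurable (E Q) by exact: measurable_cube_sub_Xt.
have trE (v : {ffun 'I_d -> int}) Q w : E (cube_shift v Q) w <-> E Q (translate v w).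
  exact: cube_sub_Xt_shift.
exists (\int[P]_w type_count E k w).
apply: (density_cvg (F := fun=> type_count E k) (M := (size (shapes d k))%:R)).
- by move=> _; exact: bmeas_type_count.
- exact: bmeas_type_count.
- by move=> _ w; exact: norm_type_count.
- by move=> w; exact: cvg_cst.
- move=> K n w; rewrite -count_cubes// ler_nat; exact: num_cubes_ge.
- move=> n w; rewrite -count_cubes// ler_nat; exact: num_cubes_le.
Qed.

Lemma num_leading_cvg (t : R) k : exists c : R, {ae P, forall w,
  (fun n => (num_leading w t k n)%:R / (2 * n)%:R ^+ d) @ \oo --> c}.
Proof.
pose EK K Q := [set w : Omega R d | local_lead w t k K Q].
pose E Q := [set w : Omega R d | leading_cube (Xt w t) k Q].
have mEK K Q : measurable (EK K Q) by exact: measurable_local_lead.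
have mE Q : measurable (E Q) by exact: measurable_leading_cube.
have trEK K (v : {ffun 'I_d -> int}) Q w : EK K (cube_shift v Q) w <-> EK K Q (translate v w).
  exact: local_lead_shift.
have trE (v : {ffun 'I_d -> int}) Q w : E (cube_shift v Q) w <-> E Q (translate v w).
  exact: leading_cube_shift.
exists (\int[P]_w type_count E k w).
apply: (density_cvg (F := fun K => type_count (EK K) k) (M := (size (shapes d k))%:R)).
- by move=> K; exact: bmeas_type_count.
- exact: bmeas_type_count.
- by move=> K w; exact: norm_type_count.
- move=> w; rewrite /type_count; elim: (shapes d k) => [|s l IH].
    under eq_fun do rewrite big_nil; rewrite big_nil; exact: cvg_cst.
  under eq_fun do rewrite big_cons; rewrite big_cons; apply: cvgD => //.
  (* For each shape the indicators are eventually constant in [K]: a leading cube is a local lead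
     for some [K0], hence for all larger [K], and any other cube is never one. *)
  apply: cvg_near_cst; have [Es|Es] := pselect (E (cube_of 0 s) w).
    have [K0 h] := leading_local_lead Es; exists K0 => // K /= KK.
    by rewrite !indicE !mem_set//; exact: local_lead_mono h.
  apply: nearW => K; rewrite !indicE !memNset//.
  by move=> /local_lead_leading.
- move=> K n w; rewrite -count_cubes// ler_nat; exact: num_leading_ge.
- move=> n w; rewrite -count_cubes// ler_nat; exact: num_leading_le.
Qed.

End Densities.

Theorem theorem2p8 (R : realType) (d : nat) (P : probability (Omega R d) R)
  (P01 : P [set w : Omega R d | forall Q, 0 <= w Q <= 1] = 1%E)
  (Pstat : stationary P) (Perg : ergodic P)
  (q : nat) (hq : (q < d)%N) (t : R) (ht : 0 <= t <= 1) :
  exists beta_hat : R,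
    {ae P, forall w : Omega R d,
      (fun n : nat => (beta_n w q n t)%:R / ((2 * n)%:R ^+ d)) @ \oo
        --> beta_hat}.
Proof.
have [a aP] := num_leading_cvg Pstat Perg t q.
have [b bP] := num_leading_cvg Pstat Perg t q.+1.
have [c cP] := num_cubes_cvg Pstat Perg t q.+1.
exists (a + b - c); apply: filterS3 aP bP cP => w aw bw cw.
have betaE n : (beta_n w q n t)%:R = (num_leading w t q n)%:R +
    (num_leading w t q.+1 n)%:R - (num_cubes w t q.+1 n)%:R :> R.
  by rewrite -natrD -betti_num natrD addrK.
under eq_fun do rewrite betaE mulrBl mulrDl.
by apply: cvgB => //; exact: cvgD.
Qed.
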